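(* For all $m,k\in\mathbb N$ with $1\le k\le m$, \[\mathrm{BH}^{\mathrm{mult}}_{\ell_{\frac{2m}{m+1},\frac{2k}{k+1}}}(m)\le 2\binom{m}{k}^{3/2}A_{\frac{2k}{k+1}}^{\,m-k}\,\mathrm{BH}^{\mathrm{mult}}_{\ell_{\frac{2k}{k+1}}}(k).\] In particular, for each $k\in\mathbb N$ there is $\delta(k)>0$ such that for every $m>k$, \[\mathrm{BH}^{\mathrm{mult}}_{\ell_{\frac{2m}{m+1},\frac{2(m-k)}{m-k+1}}}(m)\le m^{\delta(k)}.\]
   Context: For a finite index set $I$, $1\le p<\infty$, $1\le q<\infty$, $\|x\|_{\ell_{p,q}(I)}=\big(\sum_k(x_k^* )^q(k^{q/p}-(k-1)^{q/p})\big)^{1/q}$ with $x^*$ the non-increasing rearrangement of $(|x_i|)$; $\ell_{p,p}=\ell_p$. Let $\mathcal M(m,n)=\{(i_1,\dots,i_m):1\le i_k\le n\}$; for a complex matrix $a$ on $\mathcal M(m,n)$, $\|a\|_\infty=\sup\big|\sum_{\mathbf i}a_{\mathbf i}x^1_{i_1}\cdots x^m_{i_m}\big|$ over $x^k\in\mathbb C^n$, $\|x^k\|_\infty\le1$. $\mathrm{BH}^{\mathrm{mult}}_X(m)$ is the best constant $C\ge1$ with $\|(a_{\mathbf i})_{\mathbf i\in\mathcal M(m,n)}\|_X\le C\|a\|_\infty$ for all $n$ and all $a$. For $1\le p\le2$, $A_p\ge1$ is the best constant in the Khinchine–Steinhaus inequality: $\|(\alpha_k)_{k=1}^N\|_{\ell_2}\le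 A_p\big(\int_{\mathbb T^N}|\sum_{k=1}^N\alpha_kz_k|^p\,dz\big)^{1/p}$ for all $N$ and $\alpha_k\in\mathbb C$, $dz$ the normalized Haar measure on $\mathbb T^N$. *)

(* Defs.v *)
From HB Require Import structures.
From mathcomp Require Import all_boot all_order all_algebra.
From mathcomp Require Import all_classical all_reals all_analysis.
From mathcomp Require Import complex.
Set Implicit Arguments. Unset Strict Implicit. Unset Printing Implicit Defensive.
Import Order.TTheory GRing.Theory Num.Theory.
Import numFieldNormedType.Exports.
Local Open Scope classical_set_scope.
Local Open Scope ring_scope.
Local Open Scope complex_scope.

Section Defs.
Variable R : realType.

Definition decr_rearr (I : finType) (x : I -> R[i]) : seq R :=
  sort (fun a b : R => b <= a) [seq Normc.normc (x i) | i <- enum I].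

Definition lorentz_norm (p q : R) (I : finType) (x : I -> R[i]) : R :=
  (\sum_(k < #|I|)
      (nth 0 (decr_rearr x) k) `^ q *
      ((k.+1%:R) `^ (q / p) - (k%:R) `^ (q / p))) `^ (q^-1).

Definition lp_norm (p : R) (I : finType) (x : I -> R[i]) : R :=
  lorentz_norm p p x.

Definition multi_index (m n : nat) := {ffun 'I_m -> 'I_n}.

Definition mult_sup_norm (m n : nat) (a : multi_index m n -> R[i]) : R :=
  sup [set Normc.normc (\sum_(ii : multi_index m n) a ii * \prod_(k < m) x k (ii k))
      | x in [set x : 'I_m -> 'I_n -> R[i] | forall k j, Normc.normc (x k j) <= 1]].

(** BH^mult_{l_{p,q}}(m): the best (least) constant C >= 1 such that
    ||a||_{l_{p,q}} <= C ||a||_infty for all n and all a ( +oo if none ). *)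
Definition BHmult_lorentz (p q : R) (m : nat) : \bar R :=
  ereal_inf [set C%:E | C in
    [set C : R | 1 <= C /\
      forall (n : nat) (a : multi_index m n -> R[i]),
        lorentz_norm p q a <= C * mult_sup_norm a]].

Definition BHmult_lp (p : R) (m : nat) : \bar R := BHmult_lorentz p p m.

Definition expi (t : R) : R[i] := (cos t) +i* (sin t).

(** Integral over [0,1]^n (normalized Lebesgue = Haar measure on T^n via
    theta |-> (e^{2 pi i theta_k})_k) of f, as an iterated integral; only the
    coordinates theta_0, ..., theta_{n-1} are integrated. *)
Fixpoint cube_int (n : nat) (f : (nat -> R) -> R) : R :=
  match n with
  | 0 => f (fun _ => 0)
  | n'.+1 => Rintegral lebesgue_measure `[0, 1]%classic
      (fun t => cube_int n' (fun th => f (fun j => if j == n' then t else th j)))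
  end.

Definition steinhaus_Lp (p : R) (N : nat) (alpha : 'I_N -> R[i]) : R :=
  (cube_int N (fun th =>
     Normc.normc (\sum_(k < N) alpha k * expi (2 * pi * th (nat_of_ord k))) `^ p))
  `^ (p^-1).

Definition l2_norm (N : nat) (alpha : 'I_N -> R[i]) : R :=
  Num.sqrt (\sum_(k < N) Normc.normc (alpha k) ^+ 2).

Definition KS_const (p : R) : \bar R :=
  ereal_inf [set A%:E | A in
    [set A : R | 1 <= A /\
      forall (N : nat) (alpha : 'I_N -> R[i]),
        l2_norm alpha <= A * steinhaus_Lp p alpha]].

End Defs.

(* Main.v *)
Require Import Defs.
From HB Require Import structures.
From mathcomp Require Import all_boot all_order all_algebra.
From mathcomp Require Import all_classical all_reals all_analysis.
From mathcomp Require Import complex ring lra.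
Import Order.TTheory GRing.Theory Num.Theory.
Import numFieldNormedType.Exports.
Local Open Scope ring_scope.

Set Implicit Arguments.
Unset Strict Implicit.
Unset Printing Implicit Defensive.

(* Let t = k/(k+1), q = 2t, p = 2m/(m+1), and call the mixed norm of a along a
   k-subset S of the coordinates the quantity
     M_S = sum over i_S of (sum over the other indices of |a_i|^2)^t.

   Combinatorial part. Only the m cyclic windows S of length k are used; each
   coordinate lies in exactly k of them, and m <= C(m,k) when k < m. For each
   window, rank the points i_S by decreasing fibre mass, and charge i to the
   window in which its rank is largest. By Shearer's inequality at most N^(m/k)
   points have all their ranks below N, so that Young's inequality in each
   fibre and Abel summation over ranks bound the Lorentz norm:
     ||a||_(p,q)^q <= (m/k)^(1-t) * sum of M_S over the windows.
   The same estimate controls the l_p norm up to a constant, and applying it to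
   tensor powers of a removes the constant (Blei's inequality).

   Analytic part. Eliminating the m-k coordinates outside S one at a time by
   Khinchine's inequality (and Minkowski's, as q <= 2) yields
     M_S <= (A_q^(m-k) BH(k) ||a||_oo)^q,
   which gives the first claim. Interpolating L_2 between L_q and L_4 shows
   A_q <= 2^(1/(2k)), hence BH(k+1) <= 2^(1/(2k)) BH(k) by Blei's inequality
   with m = k+1, so BH(k) <= k; the second claim follows. *)

(** * Shearer's inequality *)

Section Projections.
Variables (R : realType) (I X : finType) (k : nat).

Definition proj (e : 'I_k -> I) (i : {ffun I -> X}) : {ffun 'I_k -> X} :=
  [ffun a => i (e a)].

(** Hölder's inequality with [d] equal exponents. After each [b j] is divided by its total, AM-GM
    bounds [n x] by [q] times the mean [y x] of the normalised factors, and [y] sums to 1. *)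
Lemma hoelder_slices (J : finType) (A : {set J}) (d : nat)
    (n : X -> R) (b : J -> X -> R) (P : R) :
  (0 < d)%N -> #|A| = d -> 0 <= P -> (forall x, 0 <= n x) ->
  (forall j x, 0 <= b j x) ->
  (forall x, n x ^+ d <= P * \prod_(j in A) b j x) ->
  (\sum_x n x) ^+ d <= P * \prod_(j in A) \sum_x b j x.
Proof.
move=> d0 cA P0 n0 b0 nb.
have dR : 0 < d%:R :> R by rewrite ltr0n.
have B0 j : 0 <= \sum_x b j x by apply: sumr_ge0.
(* If one of the totals vanishes, every [n x] does; otherwise all the divisions below are by
   positive numbers. *)
have [/existsP[j /andP[jA /eqP Bj]]|] := boolP [exists j in A, \sum_x b j x == 0].
  have n_0 x : n x = 0.
    have bj : b j x = 0.
      exact: (psumr_eq0P (fun i _ => b0 j i) Bj).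
    have := nb x; rewrite (bigD1 j)//= bj mul0r mulr0 => nx.
    have : n x ^+ d == 0 by rewrite eq_le nx exprn_ge0.
    by rewrite expf_eq0 d0 => /eqP.
  by rewrite big1 // expr0n eqn0Ngt d0 /= mulr_ge0// prodr_ge0.
rewrite negb_exists => /forallP Bn.
have Bp j : j \in A -> 0 < \sum_x b j x.
  by move=> jA; rewrite lt_def B0 andbT; have := Bn j; rewrite jA.
set Q := P * _.
have Q0 : 0 <= Q by rewrite mulr_ge0// prodr_ge0.
pose y x := (\sum_(j in A) b j x / \sum_z b j z) / d%:R.
have y0 x : 0 <= y x by rewrite divr_ge0 ?ler0n// sumr_ge0// => j _; rewrite divr_ge0.
have sy : \sum_x y x = 1.
  rewrite -mulr_suml exchange_big /=.
  rewrite (eq_bigr (fun=> 1)); last first.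
    by move=> j jA; rewrite -mulr_suml divff// gt_eqF ?Bp.
  by rewrite sumr_const cA divff// gt_eqF.
pose q := Q `^ (d%:R^-1).
have qd : q ^+ d = Q by rewrite -powR_mulrn ?powR_ge0// -powRrM mulVf ?gt_eqF// powRr1.
have ny x : n x <= q * y x.
  have qy0 : 0 <= q * y x by rewrite mulr_ge0 ?powR_ge0.
  rewrite -(ler_pXn2r d0) ?nnegrE// exprMn qd.
  apply: (le_trans (nb x)).
  have -> : \prod_(j in A) b j x =
      (\prod_(j in A) \sum_z b j z) * \prod_(j in A) (b j x / \sum_z b j z).
    rewrite -big_split /=; apply: eq_bigr => j jA.
    by rewrite mulrC divfK// gt_eqF ?Bp.
  rewrite mulrA ler_wpM2l// /y -cA.
  have [] // := (leif_AGM (A := A) (E := fun j => b j x / \sum_z b j z)).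
  by move=> j jA; rewrite divr_ge0.
rewrite -qd ler_pXn2r ?nnegrE ?sumr_ge0 ?powR_ge0//.
by apply: (le_trans (ler_sum _ (fun x _ => ny x))); rewrite -mulr_sumr sy mulr1.
Qed.

(* Induction on the set [U] of coordinates on which points of [E] may differ:
   slicing along one of them multiplies by Hoelder's inequality. *)
Lemma shearer (J : finType) (e : J -> 'I_k -> I) (d : nat) (E : {set {ffun I -> X}}) :
  (0 < d)%N -> (forall s, #|[set j | s \in codom (e j)]| = d) ->
  (#|E|%:R : R) ^+ d <= \prod_j #|proj (e j) @: E|%:R.
Proof.
move=> d0 cov.
suff: forall n (U : {set I}) (E : {set {ffun I -> X}}), (#|U| <= n)%N ->
    (forall i i', i \in E -> i' \in E -> forall s, s \notin U -> i s = i' s) ->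
    (#|E|%:R : R) ^+ d <= \prod_j #|proj (e j) @: E|%:R.
  by move=> /(_ _ [set: I] E (leqnn _)); apply => i i' _ _ s; rewrite inE.
elim=> [|n IH] {E} U E.
  rewrite leqn0 cards_eq0 => /eqP -> agree.
  have [->|[i0 i0E]] := set_0Vmem E.
    by rewrite cards0 expr0n eqn0Ngt d0 /= prodr_ge0.
  have -> : E = [set i0].
    apply/setP => i; rewrite inE; apply/idP/eqP => [iE|->//].
    by apply/ffunP => s; apply: agree => //; rewrite inE.
  rewrite cards1 expr1n; under eq_bigr do rewrite imset_set1 cards1.
  by rewrite big1.
move=> cU agree.
have [U0|[u uU]] := set_0Vmem U.
  by apply: (IH U) => //; rewrite U0 cards0.
pose Es x := [set i in E | i u == x].
have EsE x : Es x \subset E by apply/fintype.subsetP => i; rewrite inE => /andP[].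
have cE : #|E| = (\sum_x #|Es x|)%N.
  rewrite -sum1_card (partition_big (fun i : {ffun I -> X} => i u) predT)//=.
  by apply: eq_bigr => x _; rewrite -sum1_card; apply: eq_bigl => i; rewrite inE.
pose A := [set j | u \in codom (e j)].
have slice x : (#|Es x|%:R : R) ^+ d <=
    (\prod_(j | j \notin A) #|proj (e j) @: E|%:R) *
    \prod_(j in A) #|proj (e j) @: Es x|%:R.
  have cUu : (#|U :\ u| <= n)%N by rewrite (cardsD1 u U) uU in cU.
  apply: (le_trans (IH (U :\ u) (Es x) cUu _)).
    move=> i i'; rewrite !inE => /andP[iE /eqP iu] /andP[i'E /eqP iu'] s.
    rewrite !inE negb_and negbK => /orP[/eqP ->|sU]; first by rewrite iu iu'.
    exact: agree.
  (* A projection that does not read [u] is enlarged from the slice to the whole of [E]. *)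
  rewrite (bigID (fun j => j \in A))/= mulrC ler_wpM2r ?prodr_ge0//.
  apply: ler_prod => j _; rewrite ler0n ler_nat /=.
  by apply: subset_leq_card; apply: imsetS.
rewrite cE natr_sum.
have P0 : 0 <= \prod_(j | j \notin A) #|proj (e j) @: E|%:R :> R by apply: prodr_ge0.
have step := @hoelder_slices J A d (fun x => #|Es x|%:R)
  (fun j x => #|proj (e j) @: Es x|%:R) _ d0 (cov u)
  P0 (fun _ => ler0n _ _)
  (fun _ _ => ler0n _ _) slice.
apply: (le_trans step).
rewrite [leRHS](bigID (fun j => j \in A))/= mulrC ler_wpM2r ?prodr_ge0//.
apply: ler_prod => j jA; rewrite sumr_ge0//= -natr_sum ler_nat.
  (* A projection that reads [u] keeps the value [x] at position [a], so the projected slices are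
     disjoint and their sizes add up. *)
  move: jA; rewrite inE => /codomP[a ua].
  rewrite -[leqRHS]sum1_card (partition_big (fun v : {ffun 'I_k -> X} => v a) predT)//=.
  apply: leq_sum => x _; rewrite -sum1_card [leqRHS]big_mkcond /= [leqLHS]big_mkcond /=.
  apply: leq_sum => v _; case: ifP => // vE; case/imsetP: (vE) => i.
  rewrite inE => /andP[iE /eqP iu] ->.
  by rewrite imset_f// ffunE -ua iu eqxx.
Qed.

End Projections.

(** * Weighted sums and ranks *)

Section Weights.
Variable R : realType.
Implicit Types x y t : R.

Lemma young_powR x y t : 0 <= x -> 0 <= y -> 0 < t < 1 ->
  x `^ t * y `^ (1 - t) <= t * x + (1 - t) * y.
Proof.
move=> x0 y0 /andP[t0 t1].
have t1' : 0 < 1 - t by rewrite subr_gt0.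
have := @conjugate_powR R (x `^ t) (y `^ (1 - t)) t^-1 (1 - t)^-1.
rewrite !powR_ge0 !invr_gt0 t0 t1' !invrK addrC subrK -!powRrM.
rewrite !divff ?gt_eqF// !powRr1// => H.
by rewrite (mulrC t) (mulrC (1 - t)) H.
Qed.

Lemma bernoulli_expr x (n : nat) : 0 <= x -> 1 + n%:R * x <= (1 + x) ^+ n.
Proof.
move=> x0; elim: n => [|n IH]; first by rewrite mul0r addr0.
rewrite exprS; apply: (@le_trans _ _ ((1 + x) * (1 + n%:R * x))).
  rewrite -natr1 -subr_ge0 (_ : _ - _ = n%:R * x ^+ 2); last by ring.
  by rewrite mulr_ge0 ?sqr_ge0.
by rewrite ler_wpM2l// addr_ge0.
Qed.

Lemma bernoulli_powR x t : 0 <= x -> 0 < t < 1 -> x `^ t <= t * x + (1 - t).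
Proof.
by move=> x0 t01; have := young_powR x0 ler01 t01; rewrite powR1 !mulr1.
Qed.

Lemma powRB1 x t : 0 < x -> x `^ (t - 1) = x `^ t / x.
Proof. by move=> x0; rewrite powRB ?powRr1 ?ltW// (gt_eqF x0) implybT. Qed.

Lemma powRVl x t : 0 <= x -> x^-1 `^ t = x `^ (- t).
Proof. by move=> x0; rewrite -powR_inv1// -powRrM mulN1r. Qed.

(** Concavity of the power: [bernoulli_powR] at n/(n+1), multiplied by (n+1)^t. *)
Lemma powR_diff_ge (n : nat) t : 0 < t < 1 ->
  t * n.+1%:R `^ (t - 1) <= n.+1%:R `^ t - n%:R `^ t.
Proof.
move=> t01; have [t0 t1] := andP t01.
have n1 : 0 < n.+1%:R :> R by rewrite ltr0n.
have := bernoulli_powR (divr_ge0 (ler0n R n) (ltW n1)) t01.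
rewrite -(ler_pM2r (powR_gt0 t n1)) -powRM ?divr_ge0// divfK ?gt_eqF//.
rewrite powRB1//.
have -> : n%:R / n.+1%:R = 1 - n.+1%:R^-1 :> R.
  by apply: (mulIf (lt0r_neq0 n1)); rewrite mulrBl divfK ?mulVf ?gt_eqF// mul1r -natr1 addrK.
set p := _ `^ t; set q := _ `^ t; set r := _^-1; lra.
Qed.

(** Replaces the increments in the Lorentz norm by pure powers: z <= z^t for z = n/(n+1), multiplied
    by (n+1)^t. *)
Lemma powR_diff_le (n : nat) t : 0 < t <= 1 ->
  n.+1%:R `^ t - n%:R `^ t <= n.+1%:R `^ (t - 1).
Proof.
move=> /andP[t0 t1].
have n1 : 0 < n.+1%:R :> R by rewrite ltr0n.
rewrite powRB1//.
have := @ge0_ler_powR R t (ltW t0) n%:R n.+1%:R.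
case: n n1 => [|n] n1 _; first by rewrite powR0 ?gt_eqF// powR1 divr1 subr0.
rewrite lerBlDr -lerBlDl -[X in X - _]mulr1 -mulrBr.
have n0 : 0 < n.+1%:R :> R by rewrite ltr0n.
have -> : 1 - n.+2%:R^-1 = n.+1%:R / n.+2%:R :> R.
  by apply: (mulIf (lt0r_neq0 n1)); rewrite mulrBl divfK ?mulVf ?gt_eqF// mul1r -natr1 addrK.
apply: (@le_trans _ _ (n.+2%:R `^ t * (n.+1%:R / n.+2%:R) `^ t)).
  rewrite ler_wpM2l ?powR_ge0// ger1_powR// divr_gt0//= ler_pdivrMr// mul1r.
  by rewrite ler_nat.
by rewrite -powRM ?divr_ge0// mulrC divfK ?gt_eqF.
Qed.

(** The point with the largest label satisfies s i + 1 >= #|E| because labels are distinct, so its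
    term is at most #|E|^(t-1). Removing it and inducting, the sum telescopes by [powR_diff_ge]. *)
Lemma sum_inj_powR (T : finType) (s : T -> nat) (E : {set T}) t : 0 < t < 1 ->
  injective s ->
  \sum_(i in E) (s i).+1%:R `^ (t - 1) <= t^-1 * #|E|%:R `^ t.
Proof.
move=> t01 sI; have [t0 t1] := andP t01.
have [n] := ubnP #|E|; elim: n E => // n IH E; rewrite ltnS => En.
have [->|[i0 i0E]] := set_0Vmem E; first by rewrite big_set0 mulr_ge0 ?powR_ge0 ?invr_ge0 ?ltW.
case: (arg_maxnP s i0E) => i iE' imax.
have iE : i \in E by exact: iE'.
rewrite (big_setD1 i)//=.
have cE : #|E| = #|E :\ i|.+1 by rewrite (cardsD1 i) iE.
have smax z : z \in E -> (s z < (s i).+1)%N by move=> zE; exact: (imax z zE).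
have cEi : (#|E| <= (s i).+1)%N.
  rewrite -(card_in_imset (f := fun z => inord (s z) : 'I_(s i).+1)).
    by apply: leq_trans (max_card _) _; rewrite card_ord.
  by move=> x y xE yE /(congr1 val) /=; rewrite !inordK ?smax// => /sI.
apply: (@le_trans _ _ (#|E|%:R `^ (t - 1) + t^-1 * #|E :\ i|%:R `^ t)).
  apply: lerD; last by apply: IH; rewrite -ltnS -cE.
  rewrite -[_ - 1]opprB !powRN lef_pV2 ?posrE ?powR_gt0 ?ltr0n ?cE//.
  by apply: ge0_ler_powR; rewrite ?nnegrE ?subr_ge0 ?ler_nat ?ltW// -cE.
rewrite -lerBrDr -mulrBr -ler_pdivrMl ?invr_gt0// invrK cE.
exact: powR_diff_ge.
Qed.

Lemma abel_ge0 (T : finType) (f h : T -> R) (r : T -> nat) :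
  injective r -> (forall u, 0 <= f u) ->
  (forall u v, (r u <= r v)%N -> f v <= f u) ->
  (forall N, 0 <= \sum_(u | (r u < N)%N) h u) -> 0 <= \sum_u f u * h u.
Proof.
move=> rI f0 fr H0.
(* Abel summation as an induction: [y] is any level below [f] on the ranks under [N]. At the point
   of last rank, [y] may be raised to [f u] because the partial sum of [h] is nonnegative. The claim
   is the case y = 0 with [N] past all ranks. *)
suff H N y : 0 <= y -> (forall u, (r u < N)%N -> y <= f u) ->
    y * \sum_(u | (r u < N)%N) h u <= \sum_(u | (r u < N)%N) f u * h u.
  have := H (\max_u r u).+1 0 (lexx _) (fun u _ => f0 u).
  rewrite mul0r (_ : \sum_(u | _) _ = \sum_u f u * h u)//.
  by apply: eq_bigl => u; rewrite ltnS; apply: leq_bigmax.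
elim: N y => [|N IH] y y0 yf; first by rewrite !big_pred0_eq mulr0.
have [/existsP[u /eqP ru]|no] := boolP [exists u, r u == N].
  have splitN (F : T -> R) :
      \sum_(v | (r v < N.+1)%N) F v = F u + \sum_(v | (r v < N)%N) F v.
    rewrite (bigD1 u) ?ru//=; congr (_ + _); apply: eq_bigl => v.
    rewrite ltnS leq_eqVlt -ru (inj_eq rI).
    by case: eqVneq => [->|]; rewrite ?ltnn ?andbF ?andbT//= orbF.
  have Hu := H0 N.+1; rewrite !splitN in Hu *.
  apply: (@le_trans _ _ (f u * (h u + \sum_(v | (r v < N)%N) h v))).
    by rewrite ler_wpM2r// yf ?ru.
  rewrite mulrDr lerD2l; apply: IH => // v vN.
  by apply: fr; rewrite ru ltnW.
have splitN (F : T -> R) :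
    \sum_(v | (r v < N.+1)%N) F v = \sum_(v | (r v < N)%N) F v.
  apply: eq_bigl => v; rewrite ltnS leq_eqVlt.
  by move: no; rewrite negb_exists => /forallP/(_ v)/negbTE ->.
rewrite !splitN; apply: IH => // u uN; apply: yf; exact: ltnW.
Qed.

Lemma abel_le (T : finType) (f g : T -> R) (r : T -> nat) (C : R) :
  injective r -> (forall u, 0 <= f u) ->
  (forall u v, (r u <= r v)%N -> f v <= f u) ->
  (forall N, \sum_(u | (r u < N)%N) g u <= C * #|[set u | (r u < N)%N]|%:R) ->
  \sum_u f u * g u <= C * \sum_u f u.
Proof.
move=> rI f0 fr gC.
rewrite -subr_ge0 mulr_sumr -sumrB.
rewrite (eq_bigr (fun u => f u * (C - g u))) => [|u _]; last first.
  by rewrite mulrBr (mulrC C).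
apply: (abel_ge0 rI) => // N; rewrite sumrB subr_ge0; apply: (le_trans (gC N)).
by rewrite sumr_const cardsE mulr_natr.
Qed.

End Weights.

Lemma decreasing_rank (R : realType) (T : finType) (f : T -> R) :
  exists r : T -> 'I_#|T|, injective r /\
    forall u v, (r u <= r v)%N -> f v <= f u.
Proof.
pose le u v := f v <= f u.
have le_tot : total le by move=> u v; apply: le_total.
have le_trans' : transitive le by move=> u v w uv vw; exact: le_trans vw uv.
pose s := sort le (enum T).
have sz : size s = #|T| by rewrite size_sort cardE.
have ins u : u \in s by rewrite mem_sort mem_enum.
have idx u : (index u s < #|T|)%N by rewrite -sz index_mem.
exists (fun u => Ordinal (idx u)); split.
  by move=> u v [] /index_inj; apply.
move=> u v /=; have := sort_sorted le_tot (enum T); rewrite -/s => ss.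
have le_refl : reflexive le by move=> w; exact: lexx.
move=> uv; have := sorted_leq_nth le_trans' le_refl u ss.
move=> /(_ (index u s) (index v s)); rewrite !inE !index_mem => /(_ (ins _) (ins _) uv).
by rewrite !nth_index.
Qed.

(** * Mixed norms *)

(** A rank is a bijection onto its range, so this count depends only on [T] and [N]; hence ranks
    taken in different windows can be compared. *)
Lemma card_rank_lt (T : finType) (r : T -> 'I_#|T|) N : injective r ->
  #|[set u | (r u < N)%N]| = #|[set x : 'I_#|T| | (x < N)%N]|.
Proof.
move=> rI; have rB : bijective r by apply: inj_card_bij => //; rewrite card_ord.
have -> : [set u | (r u < N)%N] = r @^-1: [set x : 'I_#|T| | (x < N)%N].
  by apply/setP => u; rewrite !inE.
by rewrite on_card_preimset//; exact: onW_bij.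
Qed.

Section Windows.
Variable R : realType.

(** Young's inequality for D c_i / A and g_i, summed over i. The scale [D] is free: it is the ratio
    m/k in the window estimate and 1 in Minkowski's inequality. *)
Lemma sum_young (T : finType) (Q : pred T) (c g : T -> R) (A D t : R) :
  (forall i, 0 <= c i) -> (forall i, 0 <= g i) -> \sum_(i | Q i) c i <= A ->
  0 < D -> 0 < t < 1 ->
  \sum_(i | Q i) c i `^ t * g i `^ (1 - t) <=
    D `^ (- t) * (A `^ t * (t * D + (1 - t) * \sum_(i | Q i) g i)).
Proof.
move=> c0 g0 cA D0 t01; have [t0 t1] := andP t01.
have A0 : 0 <= A by apply: le_trans cA; rewrite sumr_ge0.
have [Az|An] := eqVneq A 0.
  rewrite big1 ?mulr_ge0 ?powR_ge0 ?addr_ge0 ?mulr_ge0 ?sumr_ge0 ?subr_ge0 ?ltW//.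
  move=> i Qi; have /psumr_eq0P-> // : \sum_(i | Q i) c i = 0.
    by apply/eqP; rewrite eq_le sumr_ge0// andbT (le_trans cA)// Az.
  by rewrite powR0 ?gt_eqF// mul0r.
have Ap : 0 < A by rewrite lt_def An.
have D0' := ltW D0.
have Ai : A^-1 `^ t = (A `^ t)^-1 by rewrite powRVl// powRN.
have step i : c i `^ t * g i `^ (1 - t) <=
    D `^ (- t) * A `^ t * (t * D / A * c i + (1 - t) * g i).
  have := young_powR (divr_ge0 (mulr_ge0 (ltW D0) (c0 i)) A0) (g0 i) t01.
  rewrite powRM ?mulr_ge0 ?invr_ge0// powRM// Ai powRN => H.
  have Dt := powR_gt0 t D0; have At := powR_gt0 t Ap.
  rewrite -(ler_pM2l Dt) -(ler_pM2r (_ : 0 < (A `^ t)^-1)) ?invr_gt0//.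
  have -> : D `^ t * ((D `^ t)^-1 * A `^ t * (t * D / A * c i + (1 - t) * g i)) / A `^ t
     = t * (D * c i / A) + (1 - t) * g i by field; rewrite !gt_eqF.
  by apply: le_trans H; rewrite le_eqVlt; apply/orP; left; apply/eqP; ring.
apply: (le_trans (ler_sum _ (fun i _ => step i))).
rewrite -mulr_sumr -[leLHS]mulrA ler_wpM2l ?powR_ge0// ler_wpM2l ?powR_ge0//.
rewrite big_split /= -!mulr_sumr lerD2r -[leRHS]mulr1 -[leLHS]mulrA ler_wpM2l//.
  by rewrite mulr_ge0// ltW.
by rewrite mulrC ler_pdivrMr// mul1r.
Qed.

Variables (I X J : finType) (k : nat) (e : J -> 'I_k -> I).

(** For c = |a|^2 and t = q/2 this is the q-th power of the l_q norm, over the window variables, of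
    the l_2 norms over the other variables. *)
Definition mixed (c : {ffun I -> X} -> R) (t : R) (j : J) : R :=
  \sum_(u : {ffun 'I_k -> X}) (\sum_(i | proj (e j) i == u) c i) `^ t.

(** [s] is meant as the position in decreasing order, and the power of s i + 1 then dominates the
    Lorentz weight. The exponent D^-1 = k/m is the one that Shearer's inequality produces. *)
Lemma le_sum_mixed (c : {ffun I -> X} -> R) (s : {ffun I -> X} -> nat)
    (t := k%:R / (k%:R + 1) : R) (D := #|J|%:R / k%:R : R) :
  (0 < k < #|J|)%N -> (forall x, #|[set j | x \in codom (e j)]| = k) ->
  (forall i, 0 <= c i) -> injective s ->
  \sum_i c i `^ t * ((s i).+1%:R `^ (D^-1 - 1)) `^ (1 - t) <=
    D `^ (1 - t) * \sum_j mixed c t j.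
Proof.
move=> /andP[k0 kJ] cov c0 sI.
have kR : 0 < k%:R :> R by rewrite ltr0n.
have mR : 0 < #|J|%:R :> R by rewrite ltr0n (ltn_trans k0).
have t01 : 0 < t < 1 by rewrite divr_gt0//= ?ltr_pdivrMr ?mul1r ?ltrDl ?addr_gt0.
have [t0 t1] := andP t01.
have D1 : 1 < D by rewrite ltr_pdivlMr// mul1r ltr_nat.
have D0 : 0 < D := lt_trans ltr01 D1.
have D01 : 0 < D^-1 < 1 by rewrite invr_gt0 D0 invf_lt1.
pose A j (u : {ffun 'I_k -> X}) := \sum_(i | proj (e j) i == u) c i.
have A0 j u : 0 <= A j u by apply: sumr_ge0.
have /choice[r Hr] : forall j, exists r : {ffun 'I_k -> X} -> 'I_#|{ffun 'I_k -> X}|,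
    injective r /\ forall u v, (r u <= r v)%N -> A j v <= A j u.
  by move=> j; exact: decreasing_rank.
have rI j : injective (r j) by case: (Hr j).
have [j0 _] : exists j : J, true.
  by have /card_gt0P[j] : (0 < #|J|)%N by exact: ltn_trans k0 kJ; exists j.
(* Each [i] is charged to the window [jj i] in which the fibre through [i] has its largest rank. *)
pose rr i j := r j (proj (e j) i) : nat.
pose jj i := [arg max_(j > j0) rr i j]%N.
have jjP i j : (rr i j <= rr i (jj i))%N.
  by rewrite /jj; case: arg_maxnP => // j' _; apply.
pose g i : R := (s i).+1%:R `^ (D^-1 - 1).
have g0 i : 0 <= g i by exact: powR_ge0.
pose W j u := \sum_(i | (jj i == j) && (proj (e j) i == u)) g i.
(* A point charged to [j] with rank below [N] there has all its ranks below [N], so it lies in [E].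
   Shearer gives |E|^k <= C^m, that is |E|^(1/D) <= C, and [sum_inj_powR] bounds the weight of [E]
   by D |E|^(1/D). *)
have WN j N : \sum_(u | (r j u < N)%N) W j u <= D * #|[set u | (r j u < N)%N]|%:R.
  pose E : {set {ffun I -> X}} := [set i | [forall j', rr i j' < N]%N].
  have -> : \sum_(u | (r j u < N)%N) W j u = \sum_(i | (jj i == j) && (rr i j < N)%N) g i.
    rewrite [RHS](partition_big (fun i => proj (e j) i) (fun u => r j u < N)%N); last first.
      by move=> i /andP[].
    apply: eq_bigr => u uN; apply: eq_bigl => i.
    by rewrite /rr; case: (eqVneq (proj (e j) i) u) => [->|]; rewrite ?uN ?andbT ?andbF.
  apply: (@le_trans _ _ (\sum_(i in E) g i)).
    rewrite [leLHS]big_mkcond [leRHS]big_mkcond /=; apply: ler_sum => i _.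
    case: ifP => [/andP[/eqP ij iN]|]; last by case: ifP.
    rewrite inE ifT//; apply/forallP => j'; apply: leq_ltn_trans iN.
    by rewrite -ij jjP.
  apply: (le_trans (sum_inj_powR E D01 sI)); rewrite invrK ler_pM2l//.
  set C := #|[set u | _]|.
  have EC : (#|E|%:R : R) ^+ k <= C%:R ^+ #|J|.
    apply: (le_trans (shearer R E k0 cov)); rewrite -prodr_const.
    apply: ler_prod => j' _; rewrite ler0n ler_nat /=.
    rewrite /C (card_rank_lt _ (rI j)) -(card_rank_lt _ (rI j')).
    apply: subset_leq_card; apply/fintype.subsetP => u.
    by case/imsetP => i; rewrite !inE => /forallP/(_ j') iN ->.
  rewrite /D invf_div powRrM powR_mulrn//.
  have /ge0_ler_powR : 0 <= (#|J|%:R^-1 : R) by rewrite invr_ge0 ltW.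
  move=> /(_ (#|E|%:R ^+ k) (C%:R ^+ #|J|)); rewrite !nnegrE !exprn_ge0// => /(_ isT isT EC).
  by rewrite -[(C%:R ^+ _)]powR_mulrn// -[X in _ <= X]powRrM divff ?gt_eqF// powRr1.
have stepj j : \sum_(i | jj i == j) c i `^ t * g i `^ (1 - t) <= D `^ (1 - t) * mixed c t j.
  rewrite (partition_big (proj (e j)) predT)//=.
  apply: (@le_trans _ _ (\sum_u D `^ (- t) * (A j u `^ t * (t * D + (1 - t) * W j u)))).
    apply: ler_sum => u _; apply: sum_young => //.
    rewrite /A [leLHS]big_mkcond [leRHS]big_mkcond /=; apply: ler_sum => i _.
    by case: ifP => [/andP[_ ->]//|_]; case: ifP.
  rewrite -mulr_sumr.
  have -> : D `^ (1 - t) = D `^ (- t) * D.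
    by rewrite addrC -{3}(powRr1 (ltW D0)) -powRD// (gt_eqF D0) implybT.
  rewrite -mulrA ler_wpM2l ?powR_ge0//.
  under eq_bigr do rewrite mulrDr.
  rewrite big_split /= -mulr_suml.
  under [X in _ + X <= _]eq_bigr do rewrite mulrCA.
  rewrite -mulr_sumr.
  (* [A j u] decreases with the rank and [WN] controls the initial sums of [W], so Abel summation
     replaces [W] by its average bound [D]; then t D + (1 - t) D = D. *)
  have H : \sum_u A j u `^ t * W j u <= D * mixed c t j.
    apply: (@abel_le R _ _ _ (fun u => r j u : nat)) => //.
    - by move=> u v /val_inj/rI.
    - by move=> u; exact: powR_ge0.
    - move=> u v uv; apply: (ge0_ler_powR (ltW t0)); rewrite ?nnegrE ?A0//.
      by case: (Hr j) => _; apply.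
  rewrite -/(mixed c t j); set M := mixed c t j in H *.
  have -> : D * M = M * (t * D) + (1 - t) * (D * M) by ring.
  by rewrite lerD2l ler_wpM2l// subr_ge0 ltW.
rewrite (partition_big jj predT)//= mulr_sumr.
by apply: ler_sum => j _; exact: stepj.
Qed.

End Windows.

(** * Blei's inequality *)

Definition ffst (A X1 X2 : finType) (i : {ffun A -> X1 * X2}) : {ffun A -> X1} :=
  [ffun a => (i a).1].
Definition fsnd (A X1 X2 : finType) (i : {ffun A -> X1 * X2}) : {ffun A -> X2} :=
  [ffun a => (i a).2].

Lemma sum_ffun_prod (R : realType) (A X1 X2 : finType)
    (P1 : pred {ffun A -> X1}) (P2 : pred {ffun A -> X2})
    (F1 : {ffun A -> X1} -> R) (F2 : {ffun A -> X2} -> R) :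
  \sum_(i | P1 (ffst i) && P2 (fsnd i)) F1 (ffst i) * F2 (fsnd i) =
  (\sum_(i | P1 i) F1 i) * (\sum_(i | P2 i) F2 i).
Proof.
rewrite big_distrlr /= pair_big /=.
pose fpair (u : {ffun A -> X1} * {ffun A -> X2}) : {ffun A -> X1 * X2} :=
  [ffun a => (u.1 a, u.2 a)].
have q1 u : ffst (fpair u) = u.1 by apply/ffunP => a; rewrite !ffunE.
have q2 u : fsnd (fpair u) = u.2 by apply/ffunP => a; rewrite !ffunE.
rewrite (reindex fpair) /=; first by apply: eq_big => u; rewrite q1 q2.
exists (fun i => (ffst i, fsnd i)) => [u _|i _]; first by rewrite q1 q2 -surjective_pairing.
by apply/ffunP => a; rewrite !ffunE -surjective_pairing.
Qed.

Section Blei.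
Variables (R : realType) (I J : finType) (k : nat) (e : J -> 'I_k -> I).
Local Notation m := #|J|.
Local Notation t := (k%:R / (k%:R + 1) : R).
Local Notation T := (m%:R / (m%:R + 1) : R).
Local Notation D := (m%:R / k%:R : R).
Hypothesis km : (0 < k < m)%N.
Hypothesis cov : forall x, #|[set j | x \in codom (e j)]| = k.

Let kR : 0 < k%:R :> R. Proof. by case/andP: km => k0 _; rewrite ltr0n. Qed.
Let mR : 0 < m%:R :> R.
Proof. by case/andP: km => k0 /(ltn_trans k0) m0; rewrite ltr0n. Qed.

(** Let [Y] be the sum to bound. With entries ranked decreasingly, (r i + 1) c_i^T <= Y. Since t + T
    w = T, this gives c_i^T <= Y^w c_i^t (r i + 1)^(-w), whose sum is controlled by [le_sum_mixed];
    dividing by Y^w leaves Y^(t/T). *)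
Lemma blei_crude (X : finType) (c : {ffun I -> X} -> R) :
  (forall i, 0 <= c i) -> (forall j, mixed e c t j <= 1) ->
  \sum_i c i `^ T <= (D `^ (1 - t) * m%:R) `^ (T / t).
Proof.
move=> c0 c1.
have [r [rI rc]] := decreasing_rank c.
set Y := \sum_i c i `^ T.
have Y0 : 0 <= Y by apply: sumr_ge0 => i _; exact: powR_ge0.
have [->|Yn] := eqVneq Y 0; first exact: powR_ge0.
have Yp : 0 < Y by rewrite lt_def Yn.
have kR' := kR; have mR' := mR.
have k1R : 0 < k%:R + 1 :> R by rewrite addr_gt0.
have m1R : 0 < m%:R + 1 :> R by rewrite addr_gt0.
have t0 : 0 < t by rewrite divr_gt0.
have T0 : 0 < T by rewrite divr_gt0.
pose w : R := 1 - t / T.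
have wE : w = (m%:R - k%:R) / (m%:R * (k%:R + 1)).
  by rewrite /w; field; rewrite !gt_eqF.
have w0 : 0 < w.
  by rewrite wE divr_gt0 ?mulr_gt0// subr_gt0 ltr_nat; case/andP: km.
(* Chebyshev's argument: r i + 1 entries are at least as large as c_i. *)
have cY i : c i `^ T * (r i).+1%:R <= Y.
  have -> : (r i).+1 = #|[set z | (r z < (r i).+1)%N]|.
    rewrite (card_rank_lt _ rI) -[LHS](card_ord) -(card_in_imset (f := widen_ord (ltn_ord (r i)))).
      apply: eq_card => x; rewrite inE; apply/imsetP/idP => [[y _ ->]//=|xi].
      by exists (Ordinal xi) => //; apply: val_inj.
    by move=> x y _ _ /(congr1 val) /= xy; apply: val_inj.
  rewrite mulr_natr -sumr_const.
  rewrite [leLHS]big_mkcond; apply: ler_sum => z _; rewrite inE ltnS.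
  case: ifP => [zi|_]; last exact: powR_ge0.
  by apply: (ge0_ler_powR (ltW T0)); rewrite ?nnegrE// rc.
have cT i : c i `^ T <= Y `^ w * (c i `^ t * ((r i).+1%:R `^ (D^-1 - 1)) `^ (1 - t)).
  have [->|cn] := eqVneq (c i) 0.
    by rewrite powR0 ?gt_eqF// mulr_ge0 ?mulr_ge0 ?powR_ge0.
  have cp : 0 < c i by rewrite lt_def cn c0.
  have r1 : 0 < (r i).+1%:R :> R by rewrite ltr0n.
  have -> : c i `^ T = c i `^ t * (c i `^ T) `^ w.
    rewrite -powRrM -powRD; last by rewrite (gt_eqF cp) implybT.
    by congr (_ `^ _); rewrite /w; field; rewrite !gt_eqF.
  rewrite mulrCA ler_wpM2l ?powR_ge0// -[(_ `^ (D^-1 - 1)) `^ _]powRrM.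
  have -> : (D^-1 - 1) * (1 - t) = - w by rewrite wE; field; rewrite !gt_eqF.
  rewrite powRN -ler_pdivrMr ?invr_gt0 ?powR_gt0// invrK -powRM ?powR_ge0//.
  by apply: (ge0_ler_powR (ltW w0)); rewrite ?nnegrE ?mulr_ge0 ?powR_ge0.
have key := le_sum_mixed km cov c0 (s := fun i => r i : nat) (fun x y => (fun h => rI x y (val_inj h))).
set K := D `^ (1 - t) in key *.
have YK : Y <= Y `^ w * (K * m%:R).
  apply: (le_trans (ler_sum _ (fun i _ => cT i))); rewrite -mulr_sumr.
  rewrite ler_wpM2l ?powR_ge0//; apply: (le_trans key).
  rewrite ler_wpM2l ?powR_ge0//; apply: (le_trans (ler_sum _ (fun j _ => c1 j))).
  by rewrite sumr_const.
have YtT : Y `^ (t / T) <= K * m%:R.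
  rewrite -(ler_pM2l (powR_gt0 w Yp)) -powRD; last by rewrite (gt_eqF Yp) implybT.
  by rewrite /w subrK powRr1.
have Km0 : 0 <= K * m%:R by rewrite mulr_ge0 ?powR_ge0 ?ltW.
have : (Y `^ (t / T)) `^ (T / t) <= (K * m%:R) `^ (T / t).
  by apply: (ge0_ler_powR (divr_ge0 (ltW T0) (ltW t0))); rewrite ?nnegrE ?powR_ge0.
rewrite -powRrM (_ : t / T * (T / t) = 1) ?powRr1//.
by field; rewrite !gt_eqF.
Qed.

(* Both sides are multiplicative under tensor squares [c (x) c], which removes
   the constant of [blei_crude]. *)
Lemma blei_power N (X : finType) (c : {ffun I -> X} -> R) :
  (forall i, 0 <= c i) -> (forall j, mixed e c t j <= 1) ->
  (\sum_i c i `^ T) ^+ (2 ^ N) <= (D `^ (1 - t) * m%:R) `^ (T / t).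
Proof.
elim: N X c => [|N IH] X c c0 c1; first by rewrite expr1; exact: blei_crude.
pose c2 (i : {ffun I -> X * X}) := c (ffst i) * c (fsnd i).
have sq : (\sum_i c i `^ T) ^+ 2 = \sum_i c2 i `^ T.
  rewrite expr2 -(sum_ffun_prod predT predT) /=.
  by apply: eq_bigr => i _; rewrite powRM.
rewrite expnS exprM sq; apply: IH => [i|j]; first exact: mulr_ge0.
rewrite /mixed.
have -> : \sum_(u : {ffun 'I_k -> X * X}) (\sum_(i | proj (e j) i == u) c2 i) `^ t =
   mixed e c t j * mixed e c t j.
  rewrite /mixed -(sum_ffun_prod predT predT) /=; apply: eq_bigr => u _.
  rewrite -powRM ?sumr_ge0// -sum_ffun_prod; congr (_ `^ _); apply: eq_bigl => i.
  apply/eqP/andP => [<-|[/eqP/ffunP h1 /eqP/ffunP h2]].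
    by split; apply/eqP/ffunP => a; rewrite !ffunE.
  apply/ffunP => a; have := h1 a; have := h2 a; rewrite !ffunE.
  by case: (i _) (u a) => ? ? [? ?] /= -> ->.
have m0 : 0 <= mixed e c t j by apply: sumr_ge0 => u _; exact: powR_ge0.
by rewrite mulr_ile1.
Qed.

Lemma le1_bounded_powers (y B : R) : (forall N, y ^+ (2 ^ N) <= B) -> y <= 1.
Proof.
move=> yB; rewrite leNgt; apply/negP => y1.
have y1' : 0 < y - 1 by rewrite subr_gt0.
have bern n : 1 + n%:R * (y - 1) <= y ^+ n.
  by have := bernoulli_expr n (ltW y1'); rewrite [1 + (y - 1)]addrC subrK.
pose n := (Num.truncn (B / (y - 1))).+1.
have nB : B < n%:R * (y - 1) by rewrite -ltr_pdivrMr// truncnS_gt.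
suff: B < B by rewrite ltxx.
apply: (lt_le_trans nB); apply: le_trans (yB n); apply: le_trans (bern _).
rewrite (@le_trans _ _ ((2 ^ n)%:R * (y - 1)))//; last by rewrite lerDr.
rewrite ler_wpM2r//; first exact: ltW.
by rewrite ler_nat ltnW// ltn_expl.
Qed.

Lemma blei (X : finType) (c : {ffun I -> X} -> R) (L : R) :
  (forall i, 0 <= c i) -> 0 < L -> (forall j, mixed e c t j <= L `^ t) ->
  \sum_i c i `^ T <= L `^ T.
Proof.
move=> c0 L0 cL.
have L0' := ltW L0.
have Li : 0 <= L^-1 by rewrite invr_ge0.
have E x : L^-1 `^ x = (L `^ x)^-1 by rewrite powRVl// powRN.
have H : \sum_i (L^-1 * c i) `^ T <= 1.
  apply: (@le1_bounded_powers _ ((D `^ (1 - t) * m%:R) `^ (T / t))) => N.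
  apply: blei_power => [i|j]; first exact: mulr_ge0.
  rewrite /mixed (eq_bigr (fun u : {ffun 'I_k -> X} =>
    L^-1 `^ t * (\sum_(i | proj (e j) i == u) c i) `^ t)).
    by rewrite -mulr_sumr E ler_pdivrMl ?powR_gt0// mulr1; exact: cL.
  by move=> u _; rewrite -mulr_sumr powRM// sumr_ge0.
rewrite -[leRHS]mulr1 -ler_pdivrMl ?powR_gt0//; apply: le_trans H.
by rewrite mulr_sumr le_eqVlt; apply/orP; left; apply/eqP/eq_bigr => i _; rewrite powRM// E.
Qed.

End Blei.

(** * Lorentz norms *)

Section Lorentz.
Variable R : realType.
Local Notation normc := (@Normc.normc R).

Lemma normc_ge0 (z : R[i]) : 0 <= normc z.
Proof. by case: z => a b; exact: sqrtr_ge0. Qed.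

(** Listing the points by rank gives a decreasing list with the same values as the rearrangement,
    and sorted permutations of one another coincide. Sums over the rearrangement thus become sums
    over the index set. *)
Lemma lorentz_sum (T : finType) (x : T -> R[i]) : exists r : T -> 'I_#|T|,
  injective r /\ forall (F : R -> R) (w : nat -> R),
  \sum_(k < #|T|) F (nth 0 (decr_rearr x) k) * w k = \sum_i F (normc (x i)) * w (r i).
Proof.
have [r [rI rx]] := decreasing_rank (fun i => normc (x i)).
exists r; split=> // F w.
have [g rg gr] : bijective r by apply: inj_card_bij => //; rewrite card_ord.
have nthE j (jT : (j < #|T|)%N) :
    [seq normc (x (g k)) | k <- enum 'I_#|T|]`_j = normc (x (g (Ordinal jT))).
  rewrite (nth_map (Ordinal jT)) ?size_enum_ord//; congr (normc (x (g _))).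
  by apply: val_inj; rewrite /= nth_enum_ord.
have -> : decr_rearr x = [seq normc (x (g k)) | k <- enum 'I_#|T|].
  have le_tot : total (fun a b : R => b <= a) by move=> a b; exact: le_total.
  apply: (@sorted_eq _ (fun a b : R => b <= a)).
  - by move=> a b c ba ac; exact: le_trans ac ba.
  - by move=> a b /andP[ba ab]; apply/eqP; rewrite eq_le ab.
  - exact: sort_sorted.
  - apply/(sortedP 0) => i; rewrite size_map size_enum_ord => iT.
    rewrite (nthE _ iT) (nthE _ (ltnW iT)) /=.
    by apply: rx; rewrite !gr /=.
  - rewrite perm_sort (map_comp (fun i => normc (x i)) g).
    apply: perm_map; apply: uniq_perm.
    + exact: enum_uniq.
    + by rewrite map_inj_uniq ?enum_uniq//; exact: can_inj gr.
    + move=> i; rewrite mem_enum inE; apply/esym/mapP; exists (r i) => //.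
      by rewrite mem_enum.
rewrite (reindex r) /=; last by apply: onW_bij; exists g.
apply: eq_bigr => i _; congr (F _ * _).
by rewrite nthE (_ : Ordinal _ = r i) ?rg//; apply: val_inj.
Qed.

Lemma lp_normE (T : finType) (p : R) (x : T -> R[i]) : p != 0 ->
  lp_norm p x = (\sum_i normc (x i) `^ p) `^ p^-1.
Proof.
move=> p0; rewrite /lp_norm /lorentz_norm.
have [r [_ rE]] := lorentz_sum x.
rewrite (rE (fun y => y `^ p) (fun k => k.+1%:R `^ (p / p) - k%:R `^ (p / p))).
congr (_ `^ _); apply: eq_bigr => i _.
by rewrite divff// !powRr1// -natr1 addrC addKr mulr1.
Qed.

Lemma normc_powR (z : R[i]) (q : R) : normc z `^ q = (normc z ^+ 2) `^ (q / 2).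
Proof. by rewrite -powR_mulrn ?normc_ge0// -powRrM mulrCA divff ?mulr1// pnatr_eq0. Qed.

(** By [powR_diff_le] the Lorentz weight is at most (r i + 1)^(q/p - 1). Since q/2 = t and (D^-1 -
    1)(1 - t) = q/p - 1, this is exactly the weight in [le_sum_mixed] for c = |a|^2. *)
Lemma lorentz_le_mixed (I J X : finType) (k : nat) (e : J -> 'I_k -> I)
    (a : {ffun I -> X} -> R[i])
    (t := k%:R / (k%:R + 1) : R) (D := #|J|%:R / k%:R : R) :
  (0 < k < #|J|)%N -> (forall x, #|[set j | x \in codom (e j)]| = k) ->
  lorentz_norm (2 * #|J|%:R / (#|J|%:R + 1)) (2 * k%:R / (k%:R + 1)) a <=
  (D `^ (1 - t) * \sum_j mixed e (fun i => normc (a i) ^+ 2) t j) `^ (2 * k%:R / (k%:R + 1))^-1.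
Proof.
move=> kJ cov; have /andP[k0 kJ'] := kJ.
have kR : 0 < k%:R :> R by rewrite ltr0n.
have mR : 0 < #|J|%:R :> R by rewrite ltr0n (ltn_trans k0).
have k1R : 0 < k%:R + 1 :> R by rewrite addr_gt0.
have m1R : 0 < #|J|%:R + 1 :> R by rewrite addr_gt0.
rewrite /lorentz_norm; set q := 2 * k%:R / _; set p := 2 * #|J|%:R / _.
have q0 : 0 < q by rewrite /q divr_gt0 ?mulr_gt0.
have p0 : 0 < p by rewrite /p divr_gt0 ?mulr_gt0.
have qp : 0 < q / p <= 1.
  rewrite divr_gt0//= ler_pdivrMr// mul1r /q /p ler_pdivrMr// mulrAC ler_pdivlMr//.
  have : k%:R <= #|J|%:R :> R by rewrite ler_nat ltnW.
  by set u := k%:R; set v := #|J|%:R; move=> uv; rewrite -!mulrA ler_pM2l//; lra.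
have [r [rI rE]] := lorentz_sum a.
have S0 : 0 <= \sum_i normc (a i) `^ q * ((r i).+1%:R `^ (q / p) - (r i)%:R `^ (q / p)).
  apply: sumr_ge0 => i _; rewrite mulr_ge0 ?powR_ge0// subr_ge0.
  by apply: ge0_ler_powR; rewrite ?nnegrE ?ler_nat//; case/andP: qp => /ltW.
rewrite (rE (fun y => y `^ q) (fun k => k.+1%:R `^ (q / p) - k%:R `^ (q / p))).
have key := le_sum_mixed kJ cov (fun i => sqr_ge0 (normc (a i)))
  (s := fun i => r i : nat) (fun x y => (fun h => rI x y (val_inj h))).
apply: ge0_ler_powR; rewrite ?nnegrE ?invr_ge0 ?(ltW q0)//.
  by rewrite mulr_ge0 ?powR_ge0// sumr_ge0// => j _; apply: sumr_ge0 => u _; exact: powR_ge0.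
apply: le_trans key; apply: ler_sum => i _; rewrite normc_powR.
have -> : q / 2 = t by rewrite /q /t; field; rewrite gt_eqF.
rewrite ler_wpM2l ?powR_ge0// -powRrM.
have -> : (D^-1 - 1) * (1 - t) = q / p - 1.
  by rewrite /D /t /q /p; field; rewrite !gt_eqF.
exact: powR_diff_le.
Qed.

End Lorentz.

(** * Iterated integrals over the cube *)

Section CubeInt.
Variable R : realType.
Local Notation mu := (@lebesgue_measure R).
Implicit Types f g : (nat -> R) -> R.

(** Bounded, and uniformly continuous in the first [n] coordinates, hence independent of the others.
    This class is stable under slicing, and uniformity makes the integrals of slices continuous in
    the sliced variable. *)
Definition nice n f : Prop :=
  (exists M, forall x, `|f x| <= M) /\
  forall eps, 0 < eps -> exists2 d, 0 < d &
    forall x y, (forall j, (j < n)%N -> `|x j - y j| <= d) -> `|f x - f y| <= eps.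

Definition slice n (t : R) f : (nat -> R) -> R :=
  fun th => f (fun j => if j == n then t else th j).

Lemma nice_slice n t f : nice n.+1 f -> nice n (slice n t f).
Proof.
move=> [[M fM] fu]; split; first by exists M => x; exact: fM.
move=> eps eps0; have [d d0 fd] := fu _ eps0; exists d => // x y xy.
apply: fd => j; rewrite ltnS leq_eqVlt; case: eqVneq => [_ _|jn /= ?].
  by rewrite subrr normr0 ltW.
exact: xy.
Qed.

Lemma nice_cst n c : nice n (fun=> c).
Proof.
split; first by exists `|c|.
by move=> eps eps0; exists 1 => // x y _; rewrite subrr normr0 ltW.
Qed.

Lemma niceD n f g : nice n f -> nice n g -> nice n (fun x => f x + g x).
Proof.
move=> [[M fM] fu] [[N gN] gu]; split.
  by exists (M + N) => x; apply: (le_trans (ler_normD _ _)); exact: lerD.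
move=> eps eps0; have e2 : 0 < eps / 2 by rewrite divr_gt0.
have [d1 d10 fd] := fu _ e2; have [d2 d20 gd] := gu _ e2.
exists (Num.min d1 d2); first by rewrite lt_min d10.
move=> x y xy; have -> : f x + g x - (f y + g y) = (f x - f y) + (g x - g y) by ring.
apply: (le_trans (ler_normD _ _)); rewrite [leRHS]splitr lerD//.
  by apply: fd => j /xy; rewrite le_min => /andP[].
by apply: gd => j /xy; rewrite le_min => /andP[].
Qed.

Lemma niceM n f g : nice n f -> nice n g -> nice n (fun x => f x * g x).
Proof.
move=> [[M fM] fu] [[N gN] gu]; split.
  by exists (M * N) => x; rewrite normrM ler_pM.
have M0 : 0 <= M by apply: le_trans (fM (fun=> 0)).
have N0 : 0 <= N by apply: le_trans (gN (fun=> 0)).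
pose K := M + N + 1; have K0 : 0 < K by rewrite ltr_wpDl ?addr_ge0.
move=> eps eps0; have e2 : 0 < eps / K by rewrite divr_gt0.
have [d1 d10 fd] := fu _ e2; have [d2 d20 gd] := gu _ e2.
exists (Num.min d1 d2); first by rewrite lt_min d10.
move=> x y xy.
have -> : f x * g x - f y * g y = (f x - f y) * g x + f y * (g x - g y) by ring.
have h1 : `|f x - f y| <= eps / K by apply: fd => j /xy; rewrite le_min => /andP[].
have h2 : `|g x - g y| <= eps / K by apply: gd => j /xy; rewrite le_min => /andP[].
apply: (le_trans (ler_normD _ _)); rewrite !normrM.
apply: (@le_trans _ _ (eps / K * N + M * (eps / K))).
  by apply: lerD; apply: ler_pM.
have -> : eps / K * N + M * (eps / K) = eps * ((M + N) / K) by field; rewrite gt_eqF.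
by rewrite -[leRHS]mulr1 ler_pM2l// ler_pdivrMr// mul1r lerDl.
Qed.

Lemma nice_lin n f g (a b : R) : nice n f -> nice n g -> nice n (fun x => a * f x + b * g x).
Proof. by move=> nf ng; apply: niceD; apply: niceM => //; exact: nice_cst. Qed.

Lemma nice_sum n (T : finType) (P : pred T) (F : T -> (nat -> R) -> R) :
  (forall i, nice n (F i)) -> nice n (fun x => \sum_(i | P i) F i x).
Proof.
move=> nF; have -> : (fun x => \sum_(i | P i) F i x) = \sum_(i | P i) F i.
  by apply/funext => x; rewrite fct_sumE.
elim/big_ind: _ => [|f g|i _] //; first exact: nice_cst.
exact: niceD.
Qed.

(** Subadditivity of the power: if x is the larger, then y/x and (x-y)/x lie in [0,1], where z <=
    z^s, and they add up to 1. *)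
Lemma powR_diff_norm (x y s : R) : 0 <= x -> 0 <= y -> 0 < s < 1 ->
  `|x `^ s - y `^ s| <= `|x - y| `^ s.
Proof.
move=> + + /andP[s0 s1]; have s1' := ltW s1.
wlog xy : x y / y <= x.
  move=> H x0 y0; have [/H|/ltW/H] := leP y x; first exact.
  by rewrite distrC (distrC x); apply.
move=> x0 y0; rewrite !ger0_norm ?subr_ge0//; last first.
  by apply: (ge0_ler_powR (ltW s0)); rewrite ?nnegrE.
have [->|xn] := eqVneq x 0; first by
  rewrite powR0 ?gt_eqF// sub0r (le_trans _ (powR_ge0 _ _))// oppr_le0 powR_ge0.
have xp : 0 < x by rewrite lt_def xn.
have sub z : 0 <= z <= 1 -> z <= z `^ s.
  move=> /andP[]; rewrite le_eqVlt => /predU1P[<- _|z0 z1]; first exact: powR_ge0.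
  by rewrite ger1_powR// z0.
have h1 : y / x <= (y / x) `^ s.
  by apply: sub; rewrite divr_ge0//= ler_pdivrMr// mul1r.
have h2 : (x - y) / x <= ((x - y) / x) `^ s.
  by apply: sub; rewrite divr_ge0 ?subr_ge0//= ler_pdivrMr// mul1r gerBl.
have h : 1 <= (y / x) `^ s + ((x - y) / x) `^ s.
  by apply: le_trans (lerD h1 h2); rewrite -mulrDl addrC subrK divff.
rewrite lerBlDl -[X in X <= _]mul1r.
apply: le_trans (ler_wpM2r (powR_ge0 x s) h) _.
by rewrite mulrDl -!powRM ?divr_ge0 ?subr_ge0// !divfK.
Qed.

Lemma nice_powR n f s : 0 < s < 1 -> (forall x, 0 <= f x) -> nice n f ->
  nice n (fun x => f x `^ s).
Proof.
move=> s01 f0 [[M fM] fu]; have /andP[s0 s1] := s01; split.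
  exists (M `^ s) => x; rewrite ger0_norm ?powR_ge0//.
  apply: (ge0_ler_powR (ltW s0)); rewrite ?nnegrE//.
    by apply: le_trans (fM x).
  by apply: le_trans (fM x); rewrite ler_norm.
move=> eps eps0; have [d d0 fd] := fu _ (powR_gt0 s^-1 eps0); exists d => // x y xy.
apply: (le_trans (powR_diff_norm _ _ s01)) => //.
have -> : eps = (eps `^ s^-1) `^ s by rewrite -powRrM mulVf ?gt_eqF// powRr1 ?ltW.
by apply: (ge0_ler_powR (ltW s0)); rewrite ?nnegrE ?powR_ge0// fd.
Qed.

Lemma cos_lip (x y : R) : `|cos x - cos y| <= `|x - y|.
Proof.
wlog xy : x y / y < x.
  move=> H; have [/H//|/H|->] := ltgtP y x; last by rewrite !subrr normr0.
  by rewrite distrC (distrC x).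
have [c _ ->] := @MVT R cos (fun z => - sin z) y x xy (fun z _ => is_derive_cos z)
  (continuous_subspaceT (@continuous_cos R)).
by rewrite normrM normrN ler_piMl// sin_max.
Qed.

Lemma nice_cos n j (a b : R) : (j < n)%N -> nice n (fun x => cos (a * x j + b)).
Proof.
move=> jn; split; first by exists 1 => x; exact: cos_max.
move=> eps eps0; have a1 : 0 < `|a| + 1 by rewrite ltr_wpDl.
exists (eps / (`|a| + 1)); first by rewrite divr_gt0.
move=> x y xy; apply: (le_trans (cos_lip _ _)).
have -> : a * x j + b - (a * y j + b) = a * (x j - y j) by ring.
rewrite normrM; apply: (le_trans (ler_wpM2l (normr_ge0 _) (xy j jn))).
by rewrite mulrCA ler_piMr ?ltW// ltr_pdivrMr// mul1r ltrDl.
Qed.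

Lemma continuous_integrable01 (h : R -> R) : continuous h ->
  mu.-integrable `[0, 1]%classic (EFin \o h).
Proof.
move=> ch; apply: continuous_compact_integrable; first exact: segment_compact.
exact: continuous_subspaceT.
Qed.

(** Monotonicity, linearity and normalisation are proved together: all three in dimension [n] are
    used to show that the inner integral is continuous, hence integrable, in the next variable. *)
Lemma cube_int_theory n :
  [/\ forall f g, nice n f -> nice n g -> (forall x, f x <= g x) ->
        cube_int n f <= cube_int n g,
      forall f g a b, nice n f -> nice n g ->
        cube_int n (fun x => a * f x + b * g x) = a * cube_int n f + b * cube_int n g &
      forall c : R, cube_int n (fun=> c) = c].
Proof.
elim: n => [|n [IHle IHlin IHc]]; first by split => //= f g _ _; apply.
have ci f : nice n.+1 f -> continuous (fun t => cube_int n (slice n t f)).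
  move=> nf t; apply/cvgrPdist_le => eps eps0.
  have [_ /(_ _ eps0)[d d0 fd]] := nf.
  have cl u : `|u - t| <= d -> forall th, `|slice n t f th - slice n u f th| <= eps.
    move=> ut th; apply: fd => j _; case: eqVneq => [_|_]; first by rewrite distrC.
    by rewrite subrr normr0 ltW.
  near=> u.
  have ut : `|u - t| <= d.
    by rewrite distrC; near: u; apply: (@cvgr_dist_le _ _ _ _ _ id).
  have -> : cube_int n (slice n t f) - cube_int n (slice n u f) =
      cube_int n (fun th => 1 * slice n t f th + -1 * slice n u f th).
    by rewrite IHlin ?mul1r ?mulN1r//; exact: nice_slice.
  have nl : nice n (fun th => 1 * slice n t f th + -1 * slice n u f th).
    by apply: nice_lin; exact: nice_slice.
  rewrite ler_norml -[X in X <= _](IHc (- eps)) -[X in _ && (_ <= X)](IHc eps).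
  apply/andP; split; apply: IHle => //; try exact: nice_cst.
    by move=> th; have := cl _ ut th; rewrite mul1r mulN1r ler_norml => /andP[].
  by move=> th; have := cl _ ut th; rewrite mul1r mulN1r ler_norml => /andP[].
have ii f : nice n.+1 f ->
    mu.-integrable `[0, 1]%classic (EFin \o fun t => cube_int n (slice n t f)).
  by move=> nf; apply: continuous_integrable01; exact: ci.
split.
- move=> f g nf ng fg /=; apply: le_Rintegral => //; [exact: ii|exact: ii|].
  by move=> t _; apply: IHle; [exact: nice_slice|exact: nice_slice|move=> th; exact: fg].
- move=> f g a b nf ng /=.
  rewrite -!RintegralZl//; [|exact: ii|exact: ii].
  rewrite -RintegralD//; first last.
  + by apply: continuous_integrable01 => t; apply: cvgM; [exact: cvg_cst|exact: ci].
  + by apply: continuous_integrable01 => t; apply: cvgM; [exact: cvg_cst|exact: ci].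
  by apply: eq_Rintegral => t _; rewrite -IHlin//; exact: nice_slice.
- move=> c /=; under eq_Rintegral do rewrite IHc.
  by rewrite Rintegral_cst//= lebesgue_measure_itv/= lte_fin ltr01 oppr0 adde0 mulr1.
Unshelve. all: by end_near. Qed.

End CubeInt.

(** * Khinchine's inequality for several variables *)

Section Khinchine.
Variable R : realType.
Local Notation normc := (@Normc.normc R).

Lemma sqr_normcE (z : R[i]) : normc z ^+ 2 = complex.Re z ^+ 2 + complex.Im z ^+ 2.
Proof. by case: z => a b; rewrite sqr_sqrtr// addr_ge0 ?sqr_ge0. Qed.

Lemma normc_expi (x : R) : normc (expi x) = 1.
Proof. by rewrite /expi /= cos2Dsin2 sqrtr1. Qed.

Definition trig N (alpha : 'I_N -> R[i]) (th : nat -> R) : R[i] :=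
  \sum_(k < N) alpha k * expi (2 * pi * th k).

Lemma nice_sin n j (a : R) : (j < n)%N -> nice n (fun x => sin (a * x j)).
Proof.
move=> jn; have -> : (fun x : nat -> R => sin (a * x j)) = fun x => cos (a * x j + - (pi / 2)).
  by apply/funext => x; rewrite cosBpihalf.
exact: nice_cos.
Qed.

Lemma nice_sqr_trig N (alpha : 'I_N -> R[i]) : nice N (fun th => normc (trig alpha th) ^+ 2).
Proof.
pose re th := \sum_(k < N) (complex.Re (alpha k) * cos (2 * pi * th k + 0) +
  - complex.Im (alpha k) * sin (2 * pi * th k)).
pose im th := \sum_(k < N) (complex.Re (alpha k) * sin (2 * pi * th k) +
  complex.Im (alpha k) * cos (2 * pi * th k + 0)).
have nre : nice N re.
  by apply: nice_sum => k; apply: nice_lin; [exact: nice_cos|exact: nice_sin].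
have nim : nice N im.
  by apply: nice_sum => k; apply: nice_lin; [exact: nice_sin|exact: nice_cos].
have -> : (fun th => normc (trig alpha th) ^+ 2) = fun th => re th * re th + im th * im th.
  apply/funext => th; rewrite sqr_normcE !expr2.
  have -> : complex.Re (trig alpha th) = re th.
    rewrite /trig raddf_sum; apply: eq_bigr => k _; rewrite addr0.
    by case: (alpha k) => a b /=; rewrite mulNr.
  have -> // : complex.Im (trig alpha th) = im th.
  rewrite /trig raddf_sum; apply: eq_bigr => k _; rewrite addr0.
  by case: (alpha k) => a b /=.
by apply: niceD; apply: niceM.
Qed.

Lemma cube_int_sum n (T : Type) (s : seq T) (a : T -> R) (F : T -> (nat -> R) -> R) :
  (forall i, nice n (F i)) ->
  cube_int n (fun x => \sum_(i <- s) a i * F i x) = \sum_(i <- s) a i * cube_int n (F i).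
Proof.
move=> nF; have [_ lin cst] := cube_int_theory R n.
have nS u : nice n (fun x => \sum_(i <- u) a i * F i x).
  elim: u => [|i u IH].
    by under eq_fun do rewrite big_nil; exact: nice_cst.
  under eq_fun do rewrite big_cons; apply: niceD => //.
  by apply: niceM => //; exact: nice_cst.
elim: s => [|i s IH].
  by under eq_fun do rewrite big_nil; rewrite cst big_nil.
under eq_fun do rewrite big_cons -[X in _ + X]mul1r.
by rewrite lin// big_cons IH mul1r.
Qed.

(** Minkowski's inequality, reversed since t < 1. With S the sum of the s_w, S^t is the sum of
    (s_w/S)^(1-t) s_w^t. The hypothesis applies to each term, and under the integral the weights
    s_w/S, of sum 1, are absorbed by Young's inequality. *)
Lemma cube_int_minkowski n (W : finType) (s : W -> R) (F : W -> (nat -> R) -> R) (C t : R) :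
  0 < t < 1 -> 0 <= C -> (forall w, 0 <= s w) -> (forall w x, 0 <= F w x) ->
  (forall w, nice n (F w)) ->
  (forall w, s w `^ t <= C * cube_int n (fun x => F w x `^ t)) ->
  (\sum_w s w) `^ t <= C * cube_int n (fun x => (\sum_w F w x) `^ t).
Proof.
move=> t01 C0 s0 F0 nF sF; have [t0 t1] := andP t01.
have [le lin cst] := cube_int_theory R n.
have nG : nice n (fun x => (\sum_w F w x) `^ t).
  apply: nice_powR => //; first by move=> x; apply: sumr_ge0.
  exact: nice_sum.
have G0 : 0 <= cube_int n (fun x => (\sum_w F w x) `^ t).
  by rewrite -[X in X <= _](cst 0); apply: le => // [|x]; [exact: nice_cst|exact: powR_ge0].
set S := \sum_w s w.
have S0 : 0 <= S by apply: sumr_ge0.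
have [->|Sn] := eqVneq S 0; first by rewrite powR0 ?gt_eqF// mulr_ge0.
have Sp : 0 < S by rewrite lt_def Sn.
have split_S : S `^ t = \sum_w (s w / S) `^ (1 - t) * s w `^ t.
  have -> : S `^ t = S / S * S `^ t by rewrite divff// mul1r.
  rewrite {1}/S !mulr_suml; apply: eq_bigr => w _.
  have sS : 0 <= s w / S by rewrite divr_ge0.
  have -> : s w `^ t = (s w / S) `^ t * S `^ t by rewrite -powRM// divfK.
  by rewrite mulrA -powRD ?subrK ?powRr1// ?oner_eq0.
rewrite split_S.
apply: (@le_trans _ _ (\sum_w (s w / S) `^ (1 - t) * (C * cube_int n (fun x => F w x `^ t)))).
  by apply: ler_sum => w _; rewrite ler_wpM2l ?powR_ge0.
under eq_bigr do rewrite mulrCA.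
rewrite -mulr_sumr ler_wpM2l// -cube_int_sum; last by move=> w; apply: nice_powR.
apply: le => //.
  by apply: nice_sum => w; apply: niceM; [exact: nice_cst|exact: nice_powR].
move=> x; have := @sum_young R W predT (fun w => F w x) (fun w => s w / S) _ 1 t
  (fun w => F0 w x) (fun w => divr_ge0 (s0 w) S0) (lexx _) ltr01 t01.
rewrite -mulr_suml divff// powR1 mul1r !mulr1 (addrC t) subrK mulr1 => H.
by under eq_bigr do rewrite mulrC.
Qed.

Lemma steinhaus_LpE (k N : nat) (alpha : 'I_N -> R[i])
    (t := k%:R / (k%:R + 1) : R) (q := 2 * k%:R / (k%:R + 1) : R) :
  steinhaus_Lp q alpha = (cube_int N (fun th => (normc (trig alpha th) ^+ 2) `^ t)) `^ q^-1.
Proof.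
rewrite /steinhaus_Lp; congr (cube_int _ _ `^ _).
have qt : q / 2 = t by rewrite /q /t -mulrA mulrAC divff ?mul1r// pnatr_eq0.
have -> // : (fun th : nat -> R => normc (\sum_(j < N) alpha j * expi (2 * pi * th j)) `^ q) =
   (fun th : nat -> R => (normc (trig alpha th) ^+ 2) `^ t).
by apply/funext => th; rewrite normc_powR qt.
Qed.

Lemma KS_sum_powR (k N : nat) (A : R) (alpha : 'I_N -> R[i])
    (t := k%:R / (k%:R + 1) : R) (q := 2 * k%:R / (k%:R + 1) : R) : (0 < k)%N -> 0 <= A ->
  l2_norm alpha <= A * steinhaus_Lp q alpha ->
  (\sum_j normc (alpha j) ^+ 2) `^ t <=
  A `^ q * cube_int N (fun th => (normc (trig alpha th) ^+ 2) `^ t).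
Proof.
move=> k0 A0 KS.
have kR : 0 < k%:R :> R by rewrite ltr0n.
have q0 : 0 < q by rewrite /q divr_gt0 ?mulr_gt0 ?addr_gt0.
have qt : q / 2 = t by rewrite /q /t; field; rewrite gt_eqF ?addr_gt0.
have t0 : 0 < t by rewrite -qt divr_gt0.
have t1 : t < 1 by rewrite /t ltr_pdivrMr ?mul1r ?ltrDl ?addr_gt0.
have [le _ cst] := cube_int_theory R N.
have I0 : 0 <= cube_int N (fun th => (normc (trig alpha th) ^+ 2) `^ t).
  rewrite -[X in X <= _](cst 0); apply: le => [||x]; [exact: nice_cst| |exact: powR_ge0].
  apply: nice_powR; rewrite ?t0//; [by move=> x; exact: sqr_ge0|exact: nice_sqr_trig].
have -> : cube_int N (fun th => (normc (trig alpha th) ^+ 2) `^ t) = (steinhaus_Lp q alpha) `^ q.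
  by rewrite steinhaus_LpE -/q -/t -powRrM mulVf ?gt_eqF// powRr1.
rewrite -powRM ?powR_ge0//.
have -> : (\sum_j normc (alpha j) ^+ 2) `^ t = l2_norm alpha `^ q.
  have s0 : 0 <= \sum_j normc (alpha j) ^+ 2 by apply: sumr_ge0 => j _; exact: sqr_ge0.
  by rewrite /l2_norm -powR12_sqrt// -powRrM mulrC qt.
by apply: (ge0_ler_powR (ltW q0)); rewrite ?nnegrE ?sqrtr_ge0// mulr_ge0 ?powR_ge0.
Qed.

Definition KS_ineq (q A : R) : Prop :=
  forall (N : nat) (alpha : 'I_N -> R[i]), l2_norm alpha <= A * steinhaus_Lp q alpha.

(** Trades the coordinate [j] for a point of the torus: Khinchine for fixed [v] and [w], then
    Minkowski to bring the sum over [w] under the integral, then the bound [M] integrated over a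
    cube of volume 1. *)
Lemma khinchine_step (V W : finType) (n k : nat) (b : V -> W -> 'I_n -> R[i]) (A M : R)
    (t := k%:R / (k%:R + 1) : R) (q := 2 * k%:R / (k%:R + 1) : R) :
  (0 < k)%N -> 0 <= A -> KS_ineq q A ->
  (forall th, \sum_v (\sum_w normc (trig (b v w) th) ^+ 2) `^ t <= M) ->
  \sum_v (\sum_w \sum_j normc (b v w j) ^+ 2) `^ t <= A `^ q * M.
Proof.
move=> k0 A0 KS bM.
have kR : 0 < k%:R :> R by rewrite ltr0n.
have t01 : 0 < t < 1 by rewrite divr_gt0//= ?ltr_pdivrMr ?mul1r ?ltrDl ?addr_gt0.
have [le lin cst] := cube_int_theory R n.
have nG v : nice n (fun th => (\sum_w normc (trig (b v w) th) ^+ 2) `^ t).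
  apply: nice_powR => //; first by move=> x; apply: sumr_ge0 => w _; exact: sqr_ge0.
  by apply: nice_sum => w; exact: nice_sqr_trig.
have step v : (\sum_w \sum_j normc (b v w j) ^+ 2) `^ t <=
    A `^ q * cube_int n (fun th => (\sum_w normc (trig (b v w) th) ^+ 2) `^ t).
  apply: cube_int_minkowski => //.
  - exact: powR_ge0.
  - by move=> w; apply: sumr_ge0 => j _; exact: sqr_ge0.
  - by move=> w x; exact: sqr_ge0.
  - by move=> w; exact: nice_sqr_trig.
  - by move=> w; apply: KS_sum_powR.
apply: (le_trans (ler_sum _ (fun v _ => step v))).
rewrite -mulr_sumr ler_wpM2l ?powR_ge0//.
under eq_bigr do rewrite -[cube_int _ _]mul1r.
rewrite -cube_int_sum// -[leRHS](cst M); apply: le.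
- by apply: nice_sum => v; apply: niceM; [exact: nice_cst|exact: nG].
- exact: nice_cst.
- by move=> th; under eq_bigr do rewrite mul1r; exact: bM.
Qed.

End Khinchine.

(** * Bounding the mixed norms by the sup norm *)

Section Elimination.
Variable R : realType.
Local Notation normc := (@Normc.normc R).

Definition fcons (X : finType) l (x : X) (w : {ffun 'I_l -> X}) : {ffun 'I_l.+1 -> X} :=
  [ffun s => oapp w x (unlift ord0 s)].

Lemma fcons0 (X : finType) l (x : X) (w : {ffun 'I_l -> X}) : fcons x w ord0 = x.
Proof. by rewrite ffunE unlift_none. Qed.

Lemma fconsS (X : finType) l (x : X) (w : {ffun 'I_l -> X}) s :
  fcons x w (lift ord0 s) = w s.
Proof. by rewrite ffunE liftK. Qed.

Lemma sum_ffunS (V : nmodType) (X : finType) l (F : {ffun 'I_l.+1 -> X} -> V) :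
  \sum_w F w = \sum_w \sum_x F (fcons x w).
Proof.
rewrite pair_big /= (reindex (fun u : {ffun 'I_l -> X} * X => fcons u.2 u.1)) //=.
exists (fun w : {ffun 'I_l.+1 -> X} => ([ffun s => w (lift ord0 s)], w ord0)) => [[w x] _|w _] /=.
  by rewrite fcons0; congr pair; apply/ffunP => s; rewrite ffunE fconsS.
apply/ffunP => s; have [s' ->|->] := unliftP ord0 s; last by rewrite fcons0.
by rewrite fconsS ffunE.
Qed.

Lemma sum_ffun0 (V : nmodType) (X : finType) (F : {ffun 'I_0 -> X} -> V) :
  \sum_w F w = F (ffun0 (card_ord 0)).
Proof.
apply: big_pred1 => w; apply/esym/eqP/ffunP => s.
by have := ltn_ord s; rewrite ltn0.
Qed.

Lemma khinchine_multi (V : finType) (n k l : nat) (b : V -> {ffun 'I_l -> 'I_n} -> R[i]) (A M : R)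
    (t := k%:R / (k%:R + 1) : R) (q := 2 * k%:R / (k%:R + 1) : R) :
  (0 < k)%N -> 0 <= A -> KS_ineq q A ->
  (forall z : 'I_l -> 'I_n -> R[i], (forall s j, normc (z s j) <= 1) ->
    \sum_v (normc (\sum_w b v w * \prod_s z s (w s)) ^+ 2) `^ t <= M) ->
  \sum_v (\sum_w normc (b v w) ^+ 2) `^ t <= (A `^ q) ^+ l * M.
Proof.
move=> k0 A0 KS.
elim: l b => [|l IH] b bM.
  rewrite expr0 mul1r; apply: le_trans (bM (fun _ _ => 0) _); last first.
    by move=> s j; rewrite Normc.normc0 ler01.
  apply: ler_sum => v _; rewrite !sum_ffun0 big_ord0 mulr1; exact: lexx.
under eq_bigr do rewrite sum_ffunS.
rewrite exprS -mulrA.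
apply: (khinchine_step (b := fun v w j => b v (fcons j w))) => // th.
apply: IH => z z1.
(* The torus point of the coordinate just removed becomes row 0 of the test vectors; its entries
   have modulus 1. *)
pose z' s j : R[i] := oapp (fun s' => z s' j) (expi (2 * pi * th j)) (unlift ord0 s).
apply: le_trans (bM z' _); last first.
  move=> s j; rewrite /z'; case: unliftP => [s' _|_] /=; first exact: z1.
  by rewrite le_eqVlt; apply/orP; left; apply/eqP; exact: normc_expi.
apply: ler_sum => v _; rewrite sum_ffunS le_eqVlt; apply/orP; left.
apply/eqP; congr ((normc _ ^+ 2) `^ _); apply: eq_bigr => w _.
rewrite /trig mulr_suml; apply: eq_bigr => j _.
rewrite big_ord_recl fcons0 -mulrA; congr (_ * (_ * _)); first by rewrite /z' unlift_none.
by apply: eq_bigr => s _; rewrite fconsS /z' liftK.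
Qed.

Lemma normc_sum (T : Type) (r : seq T) (P : pred T) (F : T -> R[i]) :
  normc (\sum_(i <- r | P i) F i) <= \sum_(i <- r | P i) normc (F i).
Proof.
elim/big_ind2: _ => // [|x1 x2 y1 y2 h1 h2]; first by rewrite Normc.normc0.
apply: le_trans (lerD h1 h2); exact: le_normcD.
Qed.

Lemma normc_prod (T : finType) (F : T -> R[i]) :
  normc (\prod_i F i) = \prod_i normc (F i).
Proof. by apply: (big_morph _ (@Normc.normcM R) (@Normc.normc1 R)). Qed.

Lemma has_sup_mult m n (a : multi_index m n -> R[i]) :
  has_sup [set normc (\sum_(ii : multi_index m n) a ii * \prod_(s < m) x s (ii s))
      | x in [set x : 'I_m -> 'I_n -> R[i] | forall s j, normc (x s j) <= 1]]%classic.
Proof.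
split.
  exists (normc (\sum_(ii : multi_index m n) a ii * \prod_(s < m) 0)).
  by exists (fun _ _ => 0) => // s j; rewrite Normc.normc0.
exists (\sum_(ii : multi_index m n) normc (a ii)) => _ [x x1 <-].
apply: (le_trans (normc_sum _ _ _)); apply: ler_sum => ii _.
rewrite Normc.normcM normc_prod ler_piMr ?normc_ge0//.
by apply: prodr_ile1 => s; rewrite normc_ge0 x1.
Qed.

Lemma le_mult_sup_norm m n (a : multi_index m n -> R[i]) (x : 'I_m -> 'I_n -> R[i]) :
  (forall s j, normc (x s j) <= 1) ->
  normc (\sum_(ii : multi_index m n) a ii * \prod_(s < m) x s (ii s)) <= mult_sup_norm a.
Proof.
by move=> x1; apply: ub_le_sup; [case: (has_sup_mult a) | exists x].
Qed.

Lemma mult_sup_norm_le m n (a : multi_index m n -> R[i]) (M : R) :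
  (forall x : 'I_m -> 'I_n -> R[i], (forall s j, normc (x s j) <= 1) ->
    normc (\sum_(ii : multi_index m n) a ii * \prod_(s < m) x s (ii s)) <= M) ->
  mult_sup_norm a <= M.
Proof.
move=> aM; apply: ge_sup; first by case: (has_sup_mult a).
by move=> _ [x x1 <-]; exact: aM.
Qed.

Lemma mult_sup_norm_ge0 m n (a : multi_index m n -> R[i]) : 0 <= mult_sup_norm a.
Proof.
apply: le_trans (le_mult_sup_norm a (x := fun _ _ => 0) _); first exact: normc_ge0.
by move=> s j; rewrite Normc.normc0.
Qed.

Definition BH_ineq (p q : R) (m : nat) (C : R) : Prop :=
  forall (n : nat) (a : multi_index m n -> R[i]), lorentz_norm p q a <= C * mult_sup_norm a.

(** [h] splits the coordinates into the window (left) and the [l] others (right). Khinchine replaces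
    the others by test vectors, which leaves a [k]-linear form to which the inequality [BH]
    applies. *)
Lemma mixed_le (J : finType) (m n k l : nat) (j : J) (e : J -> 'I_k -> 'I_m)
    (h : 'I_k + 'I_l -> 'I_m) (a : multi_index m n -> R[i]) (A B : R)
    (t := k%:R / (k%:R + 1) : R) (q := 2 * k%:R / (k%:R + 1) : R) :
  (0 < k)%N -> 0 <= A -> KS_ineq q A -> 0 <= B -> BH_ineq q q k B ->
  bijective h -> (forall s, e j s = h (inl s)) ->
  mixed e (fun i : {ffun 'I_m -> 'I_n} => normc (a i) ^+ 2) t j
    <= (A ^+ l * B * mult_sup_norm a) `^ q.
Proof.
move=> k0 A0 KS B0 BH [g hg gh] eh.
have kR : 0 < k%:R :> R by rewrite ltr0n.
have q0 : 0 < q by rewrite /q divr_gt0 ?mulr_gt0 ?addr_gt0.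
have qt : q / 2 = t by rewrite /q /t; field; rewrite gt_eqF ?addr_gt0.
pose glue (u : {ffun 'I_k -> 'I_n}) (w : {ffun 'I_l -> 'I_n}) : {ffun 'I_m -> 'I_n} :=
  [ffun x => match g x with inl s => u s | inr s => w s end].
have glueL u w s : glue u w (h (inl s)) = u s by rewrite ffunE hg.
have glueR u w s : glue u w (h (inr s)) = w s by rewrite ffunE hg.
pose resL (i : {ffun 'I_m -> 'I_n}) : {ffun 'I_k -> 'I_n} := [ffun s => i (h (inl s))].
pose resR (i : {ffun 'I_m -> 'I_n}) : {ffun 'I_l -> 'I_n} := [ffun s => i (h (inr s))].
have glueK i : glue (resL i) (resR i) = i.
  apply/ffunP => x; rewrite -(gh x); case: (g x) => s.
    by rewrite glueL ffunE.
  by rewrite glueR ffunE.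
have resLK u w : resL (glue u w) = u by apply/ffunP => s; rewrite ffunE glueL.
have resRK u w : resR (glue u w) = w by apply/ffunP => s; rewrite ffunE glueR.
have -> : mixed e (fun i : {ffun 'I_m -> 'I_n} => normc (a i) ^+ 2) t j =
    \sum_u (\sum_w normc (a (glue u w)) ^+ 2) `^ t.
  apply: eq_bigr => u _; congr (_ `^ _).
  rewrite (reindex_onto (glue u) resR) /=.
    apply: eq_bigl => w; rewrite resRK eqxx andbT; apply/eqP/ffunP => s.
    by rewrite ffunE eh glueL.
  move=> i /eqP <-; rewrite -[RHS]glueK; congr glue.
  by apply/ffunP => s; rewrite !ffunE eh.
have -> : (A ^+ l * B * mult_sup_norm a) `^ q =
    (A `^ q) ^+ l * (B * mult_sup_norm a) `^ q.
  rewrite -mulrA powRM ?exprn_ge0 ?mulr_ge0 ?mult_sup_norm_ge0//; congr (_ * _).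
  by rewrite -!powR_mulrn ?powR_ge0// powRAC.
apply: khinchine_multi => // z z1.
(* The [k]-linear form obtained by freezing the outer variables at [z]. Since [z] is admissible, its
   sup norm is at most that of [a]. *)
pose a' (u : multi_index k n) := \sum_w a (glue u w) * \prod_s z s (w s).
have aa : mult_sup_norm a' <= mult_sup_norm a.
  apply: mult_sup_norm_le => x x1.
  pose y p c := match g p with inl s => x s c | inr s => z s c end.
  apply: le_trans (le_mult_sup_norm a (x := y) _); last first.
    by move=> s c; rewrite /y; case: (g s).
  rewrite le_eqVlt; apply/orP; left; apply/eqP; congr normc.
  rewrite /a'; under eq_bigr do rewrite mulr_suml.
  rewrite pair_big /= [RHS](reindex (fun uw : _ * _ => glue uw.1 uw.2)) /=; last first.
    exists (fun i => (resL i, resR i)) => [[u w] _|i _] /=; last exact: glueK.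
    by rewrite resLK resRK.
  apply: eq_bigr => -[u w] _ /=; rewrite -mulrA; congr (_ * _).
  rewrite [RHS](reindex h) /=; last by apply: onW_bij; exists g.
  rewrite big_sumType /= mulrC; congr (_ * _); apply: eq_bigr => s _; rewrite /y hg.
    by rewrite glueL.
  by rewrite glueR.
have := BH n a'; rewrite -/(lp_norm q a') lp_normE ?gt_eqF// => H.
have S0 : 0 <= \sum_u normc (a' u) `^ q by apply: sumr_ge0 => u _; exact: powR_ge0.
have -> : \sum_u (normc (a' u) ^+ 2) `^ t = ((\sum_u normc (a' u) `^ q) `^ q^-1) `^ q.
  rewrite -powRrM mulVf ?gt_eqF// powRr1//.
  by apply: eq_bigr => u _; rewrite normc_powR qt.
apply: (ge0_ler_powR (ltW q0)); rewrite ?nnegrE ?powR_ge0 ?mulr_ge0 ?mult_sup_norm_ge0//.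
by apply: (le_trans H); rewrite ler_wpM2l.
Qed.

End Elimination.

(** * Cyclic windows of coordinates *)

Section CyclicWindows.
Variables (m k : nat) (km : (k <= m)%N) (m0 : (0 < m)%N).

Definition rot_ord (j : 'I_m) (s : nat) : 'I_m := Ordinal (ltn_pmod (j + s) m0).

Definition window (j : 'I_m) (s : 'I_k) : 'I_m := rot_ord j s.

Lemma rot_ord_inj j s s' : (s < m)%N -> (s' < m)%N -> rot_ord j s = rot_ord j s' -> s = s'.
Proof.
by move=> sm sm' /(congr1 val) /eqP /=; rewrite eqn_modDl !modn_small// => /eqP.
Qed.

(** The windows through [x] are those starting at x - s modulo m with s < k. The start is written x
    + (m - s) to stay within natural numbers. *)
Lemma window_cover (x : 'I_m) : #|[set j | x \in codom (window j)]| = k.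
Proof.
pose phi (s : 'I_k) : 'I_m := rot_ord x (m - s).
have sm (s : 'I_k) : (s < m)%N by apply: leq_trans (ltn_ord s) km.
have rotphi (s : 'I_k) : rot_ord (phi s) s = x.
  apply: val_inj; rewrite /= modnDml -addnA subnK; last by exact: ltnW (sm s).
  by rewrite modnDr modn_small.
have phirot j (s : 'I_k) : rot_ord (rot_ord j s) (m - s) = j.
  apply: val_inj; rewrite /= modnDml -addnA subnKC; last by exact: ltnW (sm s).
  by rewrite modnDr modn_small.
have phi_inj : injective phi.
  move=> s s' E; apply: val_inj; apply: (@rot_ord_inj (phi s) s s') => //.
  by rewrite rotphi E rotphi.
rewrite -[RHS]card_ord -(card_imset predT phi_inj).
apply: eq_card => j; rewrite inE; apply/codomP/imsetP => [[s xs]|[s _ ->]].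
  by exists s => //; rewrite /phi {1}xs phirot.
by exists s; rewrite /window rotphi.
Qed.

(** Continuing the rotation from [j] through all [m] steps, the first [k] list the window and the
    remaining m - k its complement. *)
Lemma window_extend (j : 'I_m) : exists2 h : 'I_k + 'I_(m - k) -> 'I_m,
  bijective h & forall s, window j s = h (inl s).
Proof.
have E : (k + (m - k) = m)%N by rewrite subnKC.
exists (fun x => rot_ord j (unsplit x)) => //.
apply: inj_card_bij; last by rewrite card_sum !card_ord E.
have lt z : (@unsplit k (m - k) z < m)%N by apply: leq_trans (ltn_ord _) _; rewrite E.
move=> x y /rot_ord_inj => /(_ (lt x) (lt y)) xy.
by apply: (can_inj (@unsplitK _ _)); exact: val_inj.
Qed.

End CyclicWindows.

(** * The Khinchine--Steinhaus constant *)

Section Moments.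
Variable R : realType.
Local Notation normc := (@Normc.normc R).
Local Notation mu := (@lebesgue_measure R).
Local Notation omega := (2 * pi : R).

(** The function [G] is an explicit antiderivative; all of it but the term p x takes equal values at
    0 and 1, because [w] is a period of sine and cosine. *)
Lemma Rintegral_trig_period (w p a b d f : R) :
  w != 0 -> sin w = 0 -> cos w = 1 ->
  Rintegral mu `[0, 1]%classic (fun x => p + a * cos (w * x) + b * sin (w * x)
    + d * (cos (w * x) ^+ 2 - sin (w * x) ^+ 2)
    + f * (cos (w * x) * sin (w * x))) = p.
Proof.
move=> w0 sw cw.
pose S x := sin (w * x); pose C x := cos (w * x).
have dl (x : R) : is_derive x 1 (fun z => w * z) w.
  have -> : (fun z => w * z) = cst w * id by [].
  by apply: is_derive_eq; rewrite /= scaler0 addr0 /GRing.scale /= mulr1.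
have dS (x : R) : is_derive x 1 S (cos (w * x) * w).
  exact: (@is_derive1_comp _ sin (fun z => w * z)).
have dC (x : R) : is_derive x 1 C (- sin (w * x) * w).
  exact: (@is_derive1_comp _ cos (fun z => w * z)).
pose G : R -> R := cst p * id + cst w^-1 *
  (cst a * S - cst b * C + cst d * (C * S) + cst (f / 2) * (S * S)).
have dG (x : R) : is_derive x 1 G (p + a * cos (w * x) + b * sin (w * x)
    + d * (cos (w * x) ^+ 2 - sin (w * x) ^+ 2)
    + f * (cos (w * x) * sin (w * x))).
  apply: is_derive_eq; rewrite /GRing.scale /= !mulr0 !addr0 /S /C.
  by field.
have cG : continuous G.
  by move=> x; apply: differentiable_continuous; apply/derivable1_diffP; exact: ex_derive.
rewrite /Rintegral (@continuous_FTC2 R _ G)//.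
- rewrite /G !fctE /S /C /= !mulr1 !mulr0 sw cw sin0 cos0.
  ring.
- apply: continuous_subspaceT => x.
  have cl : {for x, continuous (fun z => w * z)}.
    by apply: differentiable_continuous; apply/derivable1_diffP; exact: ex_derive.
  have cC : {for x, continuous C}.
    by apply: differentiable_continuous; apply/derivable1_diffP; exact: ex_derive.
  have cS : {for x, continuous S}.
    by apply: differentiable_continuous; apply/derivable1_diffP; exact: ex_derive.
  apply: cvgD; [apply: cvgD; [apply: cvgD; [apply: cvgD|]|]|].
  + exact: cvg_cst.
  + by apply: cvgM; [exact: cvg_cst|exact: cC].
  + by apply: cvgM; [exact: cvg_cst|exact: cS].
  + by apply: cvgM; [exact: cvg_cst|apply: cvgB; apply: cvgM].
  + by apply: cvgM; [exact: cvg_cst|apply: cvgM].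
- split.
  + by move=> x _; exact: ex_derive.
  + by apply: cvg_at_right_filter; exact: cG.
  + by apply: cvg_at_left_filter; exact: cG.
- by move=> x _; rewrite derive1E derive_val.
Qed.

Lemma Rintegral_trig (p a b d f : R) :
  Rintegral mu `[0, 1]%classic (fun x => p + a * cos (omega * x) + b * sin (omega * x)
    + d * (cos (omega * x) ^+ 2 - sin (omega * x) ^+ 2)
    + f * (cos (omega * x) * sin (omega * x))) = p.
Proof.
have E : omega = pi *+ 2 by rewrite mulr_natl.
apply: Rintegral_trig_period; rewrite ?E ?sin2pi ?cos2pi//.
by rewrite mulrn_eq0/= gt_eqF ?pi_gt0.
Qed.

Lemma sqr_normc_rot (c a : R[i]) (x : R) :
  normc (c + a * expi x) ^+ 2 = normc c ^+ 2 + normc a ^+ 2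
    + 2 * (complex.Re c * complex.Re a + complex.Im c * complex.Im a) * cos x
    + 2 * (complex.Im c * complex.Re a - complex.Re c * complex.Im a) * sin x.
Proof.
rewrite !sqr_normcE; case: c a => c1 c2 [a1 a2] /=.
have := cos2Dsin2 x; move: (cos x) (sin x) => C S CS.
have -> : a1 ^+ 2 + a2 ^+ 2 = (a1 ^+ 2 + a2 ^+ 2) * (C ^+ 2 + S ^+ 2) by rewrite CS mulr1.
by ring.
Qed.

Lemma Rintegral_sqr_normc (c a : R[i]) (s : R) :
  Rintegral mu `[0, 1]%classic (fun x => normc (c + a * expi (omega * x)) ^+ 2 + s) =
  normc c ^+ 2 + normc a ^+ 2 + s.
Proof.
rewrite -[RHS](Rintegral_trig _
  (2 * (complex.Re c * complex.Re a + complex.Im c * complex.Im a))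
  (2 * (complex.Im c * complex.Re a - complex.Re c * complex.Im a)) 0 0).
by apply: eq_Rintegral => x _; rewrite sqr_normc_rot; ring.
Qed.

Lemma Rintegral_normc4 (c a : R[i]) (s K : R) :
  Rintegral mu `[0, 1]%classic (fun x => normc (c + a * expi (omega * x)) ^+ 2 ^+ 2
     + 4 * normc (c + a * expi (omega * x)) ^+ 2 * s + K) =
  normc c ^+ 2 ^+ 2 + 4 * normc c ^+ 2 * (s + normc a ^+ 2) +
    (normc a ^+ 2 ^+ 2 + 4 * normc a ^+ 2 * s + K).
Proof.
(* The squared modulus is P + A cos + B sin. In its square, A^2 cos^2 + B^2 sin^2 has mean (A^2 +
   B^2)/2 = 2 |c|^2 |a|^2. *)
pose A := 2 * (complex.Re c * complex.Re a + complex.Im c * complex.Im a).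
pose B := 2 * (complex.Im c * complex.Re a - complex.Re c * complex.Im a).
pose P := normc c ^+ 2 + normc a ^+ 2.
rewrite -[RHS](Rintegral_trig _ (2 * P * A + 4 * s * A) (2 * P * B + 4 * s * B)
  ((A ^+ 2 - B ^+ 2) / 2) (2 * A * B)).
apply: eq_Rintegral => x _; rewrite sqr_normc_rot -/A -/B -/P.
have AB : A ^+ 2 + B ^+ 2 = 4 * (normc c ^+ 2 * normc a ^+ 2).
  by rewrite /A /B !sqr_normcE; ring.
have := cos2Dsin2 (omega * x); move: (cos _) (sin _) => C S CS.
have -> : normc c ^+ 2 ^+ 2 + 4 * normc c ^+ 2 * (s + normc a ^+ 2) +
    (normc a ^+ 2 ^+ 2 + 4 * normc a ^+ 2 * s + K) =
    P ^+ 2 + 4 * P * s + K + (A ^+ 2 + B ^+ 2) / 2 * (C ^+ 2 + S ^+ 2).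
  by rewrite AB CS /P; field.
by field.
Qed.

Lemma trig_recr N (alpha : 'I_N.+1 -> R[i]) (x : R) th :
  trig alpha (fun j => if j == N then x else th j) =
  alpha ord_max * expi (omega * x) + trig (fun k => alpha (widen_ord (leqnSn N) k)) th.
Proof.
rewrite /trig big_ord_recr /= eqxx addrC; congr (_ + _).
by apply: eq_bigr => k _; rewrite ltn_eqF.
Qed.

(** The shift [c] absorbs the term of the outermost variable, which makes the induction go
    through. *)
Lemma cube_int_sqr_trig N (alpha : 'I_N -> R[i]) (c : R[i]) :
  cube_int N (fun th => normc (c + trig alpha th) ^+ 2) =
  normc c ^+ 2 + \sum_k normc (alpha k) ^+ 2.
Proof.
elim: N alpha c => [|N IH] alpha c /=; first by rewrite /trig !big_ord0 !addr0.
under eq_Rintegral do (under eq_fun do rewrite trig_recr addrA; rewrite IH).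
rewrite big_ord_recr /=; set s := \sum_(i < N) _.
by rewrite Rintegral_sqr_normc addrAC addrA.
Qed.

(** [K] is the fourth moment at c = 0. A new coefficient a raises it by |a|^4 + 4 |a|^2 s, which is
    at most 2 (s + |a|^2)^2 - 2 s^2. *)
Lemma cube_int_normc4_trig N (alpha : 'I_N -> R[i]) :
  exists2 K, K <= 2 * (\sum_k normc (alpha k) ^+ 2) ^+ 2 & forall c,
  cube_int N (fun th => normc (c + trig alpha th) ^+ 2 ^+ 2) =
  normc c ^+ 2 ^+ 2 + 4 * normc c ^+ 2 * (\sum_k normc (alpha k) ^+ 2) + K.
Proof.
elim: N alpha => [|N IH] alpha /=.
  exists 0; first by rewrite mulr_ge0 ?sqr_ge0.
  by move=> c; rewrite /trig !big_ord0 mulr0 !addr0.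
have [K K2 IHc] := IH (fun k => alpha (widen_ord (leqnSn N) k)).
set a := alpha ord_max.
rewrite big_ord_recr /=; set s := \sum_(i < N) _ in K2 IHc *.
exists (normc a ^+ 2 ^+ 2 + 4 * normc a ^+ 2 * s + K).
  have := sqr_ge0 (normc a ^+ 2).
  by rewrite -/a; move: (normc a ^+ 2) K2 => u; lra.
move=> c; under eq_Rintegral do (under eq_fun do rewrite trig_recr addrA; rewrite IHc).
exact: Rintegral_normc4.
Qed.

End Moments.

(** * Upper bound for the Khinchine--Steinhaus constant *)

Section KhinchineConstant.
Variable R : realType.
Local Notation normc := (@Normc.normc R).

(* Interpolation of [L_2] between [L_(2k/(k+1))] and [L_4]: the weighted
   AM-GM inequality, scaled so that it integrates to [1 <= L * y `^ t] when
   [y] has mean [1] and [y ^+ 2] has mean at most [2]. *)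
Lemma interpolation_ineq (k : nat) (y : R) : (0 < k)%N -> 0 <= y ->
  y <= ((k%:R + 1) / (k%:R + 2)) * 2 `^ (k%:R + 1)^-1 * y `^ (k%:R / (k%:R + 1))
       + (k%:R + 2)^-1 / 2 * y ^+ 2.
Proof.
move=> k0 y0.
have kR : 0 < k%:R :> R by rewrite ltr0n.
have k1R : 0 < k%:R + 1 :> R by rewrite addr_gt0.
have k2R : 0 < k%:R + 2 :> R by rewrite addr_gt0.
have [->|yn] := eqVneq y 0.
  by rewrite expr0n mulr0 addr0 mulr_ge0 ?powR_ge0// mulr_ge0 ?powR_ge0// divr_ge0 ?ltW.
have yp : 0 < y by rewrite lt_def yn.
set tau := (k%:R + 1) / (k%:R + 2).
have t01 : 0 < tau < 1 by rewrite /tau divr_gt0//= ltr_pdivrMr// mul1r ltrD2l ltr1n.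
have taut : 1 - tau = (k%:R + 2)^-1 by rewrite /tau; field; rewrite gt_eqF.
set L := 2 `^ _; set t := k%:R / _.
have L0 : 0 <= L := powR_ge0 _ _.
have := young_powR (mulr_ge0 L0 (powR_ge0 y t)) (divr_ge0 (sqr_ge0 y) (ler0n R 2)) t01.
have y20 : 0 <= y ^+ 2 by exact: sqr_ge0.
have -> : (L * y `^ t) `^ tau * (y ^+ 2 / 2) `^ (1 - tau) = y.
  rewrite powRM ?powR_ge0// powRM ?invr_ge0//.
  rewrite powRVl// -powR_mulrn// /L -!powRrM.
  rewrite [X in _ * X]mulrC mulrACA.
  rewrite -powRD; last by rewrite pnatr_eq0 implybT.
  rewrite -powRD; last by rewrite (gt_eqF yp) implybT.
  have -> : (k%:R + 1)^-1 * tau + - (1 - tau) = 0.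
    by rewrite taut /tau; field; rewrite !gt_eqF.
  have -> : t * tau + 2 * (1 - tau) = 1.
    by rewrite taut /tau /t; field; rewrite !gt_eqF.
  by rewrite powRr0 mul1r powRr1.
rewrite taut => H; apply: (le_trans H).
by rewrite le_eqVlt; apply/orP; left; apply/eqP; ring.
Qed.

(** Integrate [interpolation_ineq] at y = X/s, where [X] has mean [s] and X^2 has mean at most 2
    s^2. This gives s^t <= L I with L = 2^(1/(k+1)), and the root of order q = 2k/(k+1) turns [L]
    into 2^(1/(2k)). *)
Lemma KS_ineq_le (k : nat) : (0 < k)%N ->
  KS_ineq (2 * k%:R / (k%:R + 1) : R) (2 `^ (2 * k%:R)^-1).
Proof.
move=> k0 N alpha.
have kR : 0 < k%:R :> R by rewrite ltr0n.
have k1R : 0 < k%:R + 1 :> R by rewrite addr_gt0.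
have k2R : 0 < k%:R + 2 :> R by rewrite addr_gt0.
set q : R := 2 * k%:R / (k%:R + 1); pose t : R := k%:R / (k%:R + 1).
have q0 : 0 < q by rewrite /q divr_gt0 ?mulr_gt0.
have t01 : 0 < t < 1 by rewrite divr_gt0//= ltr_pdivrMr ?mul1r ?ltrDl.
have [t0 t1] := andP t01.
have [le lin cst] := cube_int_theory R N.
pose X th := normc (trig alpha th) ^+ 2.
have nX : nice N X := nice_sqr_trig alpha.
have X0 th : 0 <= X th by exact: sqr_ge0.
have nXt : nice N (fun th => X th `^ t) by exact: nice_powR.
have nX2 : nice N (fun th => X th ^+ 2).
  by under eq_fun do rewrite expr2; exact: niceM.
rewrite steinhaus_LpE -/q -/t; set I := cube_int N _.
have I0 : 0 <= I.
  by rewrite -[X in X <= _](cst 0); apply: le => // [|x]; [exact: nice_cst|exact: powR_ge0].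
set s := \sum_j normc (alpha j) ^+ 2.
have s0 : 0 <= s by apply: sumr_ge0 => j _; exact: sqr_ge0.
have l2E : l2_norm alpha = s `^ 2^-1 by rewrite powR12_sqrt.
have [sz|sn] := eqVneq s 0.
  by rewrite l2E sz powR0 ?invr_eq0 ?pnatr_eq0// mulr_ge0 ?powR_ge0.
have sp : 0 < s by rewrite lt_def sn.
have IX : cube_int N X = s.
  rewrite -[RHS]add0r -[X in X + _](_ : normc 0 ^+ 2 = 0); last by rewrite Normc.normc0 expr0n.
  rewrite -cube_int_sqr_trig; congr cube_int; apply/funext => th.
  by rewrite add0r.
have IX2 : cube_int N (fun th => X th ^+ 2) <= 2 * s ^+ 2.
  have [K KS2 /(_ 0)] := cube_int_normc4_trig alpha.
  rewrite Normc.normc0 !expr0n /= mulr0 mul0r !add0r => KE.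
  apply: le_trans KS2; rewrite -KE le_eqVlt; apply/orP; left; apply/eqP.
  by congr cube_int; apply/funext => th; rewrite add0r.
set L : R := 2 `^ (k%:R + 1)^-1.
have main : s `^ t <= L * I.
  pose tau : R := (k%:R + 1) / (k%:R + 2).
  have pt th : 1 * X th + 0 * X th <= tau * L * (s * s `^ (- t)) * X th `^ t
        + (k%:R + 2)^-1 / 2 * s^-1 * X th ^+ 2.
    rewrite mul1r mul0r addr0.
    have := interpolation_ineq k0 (divr_ge0 (X0 th) s0).
    rewrite -(ler_pM2l sp) -/t -/L -/tau mulrCA divff// mulr1 => H.
    apply: (le_trans H); rewrite powRM ?invr_ge0//.
    have -> : s^-1 `^ t = s `^ (- t) by rewrite powRVl.
    rewrite le_eqVlt; apply/orP; left; apply/eqP.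
    by field; rewrite !gt_eqF.
  have : cube_int N (fun th => 1 * X th + 0 * X th) <= cube_int N (fun th =>
      tau * L * (s * s `^ (- t)) * X th `^ t + (k%:R + 2)^-1 / 2 * s^-1 * X th ^+ 2).
    by apply: le => //; exact: nice_lin.
  rewrite !lin// IX -/I mul1r mul0r addr0 => H.
  have H2 : s <= tau * L * (s * s `^ (- t)) * I + (k%:R + 2)^-1 * s.
    apply: (le_trans H); rewrite lerD2l.
    have -> : (k%:R + 2)^-1 * s = (k%:R + 2)^-1 / 2 * s^-1 * (2 * s ^+ 2).
      by field; rewrite !gt_eqF.
    by rewrite ler_wpM2l// !mulr_ge0 ?invr_ge0 ?ltW.
  (* The term (k+2)^-1 s is moved to the left, where 1 - (k+2)^-1 = tau. *)
  have H3 : tau * s <= tau * s * (L * I / s `^ t).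
    rewrite powRN in H2; rewrite -subr_ge0.
    rewrite -[X in 0 <= X](_ : tau * L * (s / s `^ t) * I + (k%:R + 2)^-1 * s - s = _) ?subr_ge0//.
    by rewrite /tau; field; rewrite !gt_eqF ?powR_gt0.
  move: H3; rewrite -[X in X <= _]mulr1 ler_pM2l; last by rewrite mulr_gt0// /tau divr_gt0.
  by rewrite ler_pdivlMr ?powR_gt0// mul1r.
rewrite l2E.
have -> : s `^ 2^-1 = (s `^ t) `^ q^-1.
  by rewrite -powRrM; congr (_ `^ _); rewrite /t /q; field; rewrite !gt_eqF.
have -> : 2 `^ (2 * k%:R)^-1 = L `^ q^-1.
  by rewrite -powRrM; congr (_ `^ _); rewrite /q; field; rewrite !gt_eqF.
rewrite -powRM ?powR_ge0//.
apply: ge0_ler_powR; rewrite ?nnegrE ?invr_ge0 ?powR_ge0 ?mulr_ge0 ?powR_ge0//.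
Qed.

End KhinchineConstant.

(** * Bohnenblust--Hille constants *)

Section Constants.
Variable R : realType.
Local Notation normc := (@Normc.normc R).

(** A nonempty set of constants, bounded below by 1 and closed under limits from above, contains its
    infimum. The best constants are therefore real numbers that satisfy their own inequalities. *)
Lemma ereal_inf_attained (P : R -> Prop) (C0 : R) :
  P C0 -> (forall C, P C -> 1 <= C) ->
  (forall c, (forall eps, 0 < eps -> exists2 C, P C & C <= c + eps) -> 1 <= c -> P c) ->
  exists2 c, ereal_inf [set C%:E | C in [set C | P C]]%classic = c%:E & P c.
Proof.
move=> PC0 P1 Pcl; set S := [set C | P C]%classic.
have hS : has_inf S by split; [exists C0 | exists 1 => C PC; exact: P1].
exists (inf S); first by rewrite ereal_inf_EFin//; [exact: hS.2|exact: hS.1].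
apply: Pcl; last by apply: lb_le_inf; [exact: hS.1|move=> C PC; exact: P1].
move=> eps eps0; have [C SC Ce] := inf_adherent eps0 hS.
by exists C => //; exact: ltW.
Qed.

Lemma le_mul_closed (c x y : R) (P : R -> Prop) : 0 <= y ->
  (forall C, P C -> x <= C * y) ->
  (forall eps, 0 < eps -> exists2 C, P C & C <= c + eps) -> x <= c * y.
Proof.
move=> y0 Pxy Pc; apply/ler_addgt0Pr => eps eps0.
have y1 : 0 < y + 1 by rewrite ltr_wpDl.
have [C PC Cc] := Pc _ (divr_gt0 eps0 y1).
apply: (le_trans (Pxy _ PC)); apply: (le_trans (ler_wpM2r y0 Cc)).
rewrite mulrDl lerD2l mulrAC ler_pdivrMr// ler_pM2l//.
by rewrite lerDl.
Qed.

Lemma KS_const_attained (q C0 : R) : 1 <= C0 -> KS_ineq q C0 ->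
  exists A, [/\ KS_const q = A%:E, 1 <= A & KS_ineq q A].
Proof.
move=> C1 KS0.
have [|||c E [c1 cKS]] := @ereal_inf_attained (fun A => 1 <= A /\ KS_ineq q A) C0.
- by split.
- by move=> C [].
- move=> c Pc c1; split=> // N alpha; apply: (le_mul_closed (powR_ge0 _ _) _ Pc).
  by move=> C [_]; exact.
- by exists c.
Qed.

Lemma BH_const_attained (p q : R) m C0 : 1 <= C0 -> BH_ineq p q m C0 ->
  exists B, [/\ BHmult_lorentz p q m = B%:E, 1 <= B & BH_ineq p q m B].
Proof.
move=> C1 BH0.
have [|||c E [c1 cBH]] := @ereal_inf_attained (fun A => 1 <= A /\ BH_ineq p q m A) C0.
- by split.
- by move=> C [].
- move=> c Pc c1; split=> // n a; apply: (le_mul_closed (mult_sup_norm_ge0 _) _ Pc).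
  by move=> C [_]; exact.
- by exists c.
Qed.

Lemma BH_const_le (p q : R) m C : 1 <= C -> BH_ineq p q m C ->
  (BHmult_lorentz p q m <= C%:E)%E.
Proof. by move=> C1 BH; apply: ereal_inf_lbound; exists C. Qed.

(** The factor (m/k)^(1-t) and the number [m] of windows contribute at most m^(2-t). As k + 2 <= 3
    k, this is at most m^(3q/2), which becomes m^(3/2) after the q-th root. *)
Lemma BH_lorentz_ineq (m k : nat) (A B : R) : (0 < k < m)%N ->
  0 <= A -> KS_ineq (2 * k%:R / (k%:R + 1)) A ->
  0 <= B -> BH_ineq (2 * k%:R / (k%:R + 1)) (2 * k%:R / (k%:R + 1)) k B ->
  BH_ineq (2 * m%:R / (m%:R + 1)) (2 * k%:R / (k%:R + 1)) m
    (m%:R `^ (3 / 2) * (A ^+ (m - k) * B)).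
Proof.
move=> km A0 KS B0 BH n a.
have /andP[k0 kltm] := km; have m0 : (0 < m)%N := ltn_trans k0 kltm.
have kR : 0 < k%:R :> R by rewrite ltr0n.
have mR : 1 <= m%:R :> R by rewrite ler1n.
have mR0 : 0 < m%:R :> R by rewrite ltr0n.
have k1R : 0 < k%:R + 1 :> R by rewrite addr_gt0.
pose e := window m0 (k := k).
have cov := window_cover (ltnW kltm) m0.
have cJ : (0 < k < #|'I_m|)%N by rewrite card_ord.
have := lorentz_le_mixed a cJ cov; rewrite card_ord => /le_trans; apply.
set q : R := 2 * k%:R / (k%:R + 1); set t : R := k%:R / (k%:R + 1).
have q0 : 0 < q by rewrite /q divr_gt0 ?mulr_gt0.
set M := A ^+ (m - k) * B * mult_sup_norm a.
have M0 : 0 <= M by rewrite mulr_ge0 ?mult_sup_norm_ge0// mulr_ge0 ?exprn_ge0.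
have mixedM j : mixed (window m0 (k := k)) (fun i => normc (a i) ^+ 2) t j <= M `^ q.
  have [h hB hE] := window_extend (ltnW kltm) m0 j.
  exact: (mixed_le _ k0 A0 KS B0 BH hB hE).
have sumM : \sum_j mixed (window m0 (k := k)) (fun i => normc (a i) ^+ 2) t j <= m%:R * M `^ q.
  apply: (le_trans (ler_sum _ (fun j _ => mixedM j))).
  by rewrite sumr_const card_ord mulr_natl.
have t1 : 0 < 1 - t.
  by rewrite (_ : 1 - t = (k%:R + 1)^-1) ?invr_gt0// /t; field; rewrite gt_eqF.
have Dm : (m%:R / k%:R) `^ (1 - t) <= m%:R `^ (1 - t).
  apply: (ge0_ler_powR (ltW t1)); rewrite ?nnegrE ?divr_ge0//.
  by rewrite ler_pdivrMr// ler_peMr// ler1n.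
have step : (m%:R / k%:R) `^ (1 - t) * \sum_j mixed (window m0 (k := k)) (fun i => normc (a i) ^+ 2) t j
    <= (m%:R `^ (3 / 2) * M) `^ q.
  apply: (@le_trans _ _ (m%:R `^ (1 - t) * (m%:R * M `^ q))).
    apply: ler_pM => //.
    by apply: sumr_ge0 => j _; apply: sumr_ge0 => u _; exact: powR_ge0.
  rewrite powRM ?powR_ge0// -powRrM mulrA ler_wpM2r ?powR_ge0//.
  rewrite -[X in _ * X <= _](powRr1 (ltW mR0)) -powRD; last by rewrite (gt_eqF mR0) implybT.
  apply: ler_powR => //; rewrite /t /q.
  rewrite (_ : 1 - k%:R / (k%:R + 1) + 1 = (k%:R + 2) / (k%:R + 1)); last first.
    by field; rewrite gt_eqF.
  rewrite (_ : 3 / 2 * _ = 3 * k%:R / (k%:R + 1)); last by field; rewrite gt_eqF.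
  rewrite ler_pM2r ?invr_gt0//.
  have : 1 <= k%:R :> R by rewrite ler1n.
  by lra.
have P0 : 0 <= m%:R `^ (3 / 2) * M by rewrite mulr_ge0 ?powR_ge0.
apply: (@le_trans _ _ (((m%:R `^ (3 / 2) * M) `^ q) `^ q^-1)).
  apply: ge0_ler_powR step; rewrite ?nnegrE ?invr_ge0 ?powR_ge0 ?(ltW q0)//.
  by rewrite mulr_ge0 ?powR_ge0// sumr_ge0// => j _; apply: sumr_ge0 => u _; exact: powR_ge0.
by rewrite -powRrM divff ?gt_eqF// powRr1// /M !mulrA.
Qed.

Lemma BH_lp_succ (k : nat) (A B : R) : (0 < k)%N ->
  0 <= A -> KS_ineq (2 * k%:R / (k%:R + 1)) A ->
  0 <= B -> BH_ineq (2 * k%:R / (k%:R + 1)) (2 * k%:R / (k%:R + 1)) k B ->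
  BH_ineq (2 * k.+1%:R / (k.+1%:R + 1)) (2 * k.+1%:R / (k.+1%:R + 1)) k.+1 (A * B).
Proof.
move=> k0 A0 KS B0 BH n a.
pose m := k.+1; have m0 : (0 < m)%N by [].
have kR : 0 < k%:R :> R by rewrite ltr0n.
have mR : 0 < m%:R :> R by rewrite ltr0n.
have k1R : 0 < k%:R + 1 :> R by rewrite addr_gt0.
have m1R : 0 < m%:R + 1 :> R by rewrite addr_gt0.
set p : R := 2 * m%:R / (m%:R + 1); set q : R := 2 * k%:R / (k%:R + 1) in KS BH.
have p0 : 0 < p by rewrite /p divr_gt0 ?mulr_gt0.
have q0 : 0 < q by rewrite /q divr_gt0 ?mulr_gt0.
have cov := window_cover (leqnSn k) m0.
have cJ : (0 < k < #|'I_m|)%N by rewrite card_ord k0 /=.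
set M := A * B * mult_sup_norm a.
have M0 : 0 <= M by rewrite mulr_ge0 ?mult_sup_norm_ge0// mulr_ge0.
rewrite -/(lp_norm p a) lp_normE ?gt_eqF//.
(* [blei] asks for a positive bound, whereas [M] may vanish. *)
apply/ler_addgt0Pr => eps eps0; pose L := M + eps.
have L0 : 0 < L by rewrite ltr_wpDl.
have bl : \sum_i (normc (a i) ^+ 2) `^ (m%:R / (m%:R + 1)) <= (L ^+ 2) `^ (m%:R / (m%:R + 1)).
  have := @blei R 'I_m 'I_m k (window m0 (k := k)) cJ cov 'I_n (fun i => normc (a i) ^+ 2) (L ^+ 2).
  rewrite card_ord; apply; [by move=> i; exact: sqr_ge0|by rewrite exprn_gt0|].
  move=> j; have [h hB hE] := window_extend (leqnSn k) m0 j.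
  apply: (le_trans (mixed_le a k0 A0 KS B0 BH hB hE)).
  have -> : (m - k = 1)%N by rewrite subSnn.
  rewrite expr1 -/M -/q -powR_mulrn ?(ltW L0)// -powRrM.
  have -> : 2 * (k%:R / (k%:R + 1)) = q by rewrite mulrA.
  apply: (ge0_ler_powR (ltW q0)); rewrite ?nnegrE ?(ltW L0)//.
  by rewrite lerDl ltW.
have -> : M + eps = (L `^ p) `^ p^-1 by rewrite -powRrM divff ?gt_eqF// powRr1 ?(ltW L0).
apply: ge0_ler_powR; rewrite ?nnegrE ?invr_ge0 ?powR_ge0 ?(ltW p0)//.
  by apply: sumr_ge0 => i _; exact: powR_ge0.
have pE : p = 2 * (m%:R / (m%:R + 1)) by rewrite mulrA.
rewrite [in leRHS]pE powRrM powR_mulrn ?(ltW L0)//; apply: le_trans bl.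
apply: ler_sum => i _; rewrite normc_powR.
by rewrite (_ : p / 2 = m%:R / (m%:R + 1))// pE mulrAC divff ?mul1r ?pnatr_eq0.
Qed.

Lemma BH_lp_one : BH_ineq (2 * 1%:R / (1%:R + 1)) (2 * 1%:R / (1%:R + 1)) 1 (1 : R).
Proof.
move=> n a.
have -> : 2 * 1%:R / (1%:R + 1) = 1 :> R by rewrite mulr1 divff// gt_eqF.
rewrite -/(lp_norm 1 a) lp_normE ?oner_eq0// invr1 powRr1; last first.
  by apply: sumr_ge0 => i _; exact: powR_ge0.
pose cst (j : 'I_n) : multi_index 1 n := [ffun=> j].
(* The test vector aligns the phases of all coefficients; where a coefficient is 0, its entry is 0
   by the convention on division. *)
pose x (s : 'I_1) (j : 'I_n) : R[i] := (normc (a (cst j)))%:C%C / a (cst j).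
have x1 s j : normc (x s j) <= 1.
  rewrite /x Normc.normcM Normc.normcV.
  have -> : normc (normc (a (cst j)))%:C%C = normc (a (cst j)).
    by rewrite /= expr0n addr0 sqrtr_sqr ger0_norm// normc_ge0.
  have [->|nz] := eqVneq (normc (a (cst j))) 0; first by rewrite mul0r.
  by rewrite divff.
have := le_mult_sup_norm a x1; rewrite mul1r.
have -> : \sum_(ii : multi_index 1 n) a ii * \prod_(s < 1) x s (ii s) =
    (\sum_ii normc (a ii))%:C%C.
  rewrite rmorph_sum; apply: eq_bigr => ii _; rewrite big_ord1 /x.
  have -> : cst (ii ord0) = ii by apply/ffunP => s; rewrite ffunE (ord1 s).
  have [az|nz] := eqVneq (a ii) 0; first by rewrite az Normc.normc0 mul0r.
  by rewrite mulrC divfK.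
have S0 : 0 <= \sum_ii normc (a ii) by apply: sumr_ge0 => ii _; exact: normc_ge0.
rewrite (_ : normc (_)%:C%C = \sum_ii normc (a ii)); last first.
  by rewrite /= expr0n addr0 sqrtr_sqr ger0_norm.
by apply: le_trans; apply: ler_sum => i _; rewrite powRr1 ?normc_ge0.
Qed.

(** Each step costs 2^(1/(2k)) <= 1 + 1/k, since (1 + 1/k)^(2k) >= 3 by Bernoulli, and the product
    of the factors 1 + 1/k telescopes. *)
Lemma BH_lp_poly (k : nat) : (0 < k)%N ->
  BH_ineq (2 * k%:R / (k%:R + 1)) (2 * k%:R / (k%:R + 1)) k (k%:R : R).
Proof.
elim: k => // k IH _; have [->|kn] := eqVneq k 0%N; first exact: BH_lp_one.
have k0 : (0 < k)%N by rewrite lt0n.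
have kR : 0 < k%:R :> R by rewrite ltr0n.
have E : k.+1%:R = (1 + k%:R^-1) * k%:R :> R.
  by rewrite mulrDl mulVf ?gt_eqF// mul1r -natr1.
have AB : 2 `^ (2 * k%:R)^-1 <= 1 + k%:R^-1 :> R.
  have k1 : 0 <= 1 + k%:R^-1 :> R by rewrite addr_ge0 ?invr_ge0.
  have bern : 2 <= (1 + k%:R^-1) ^+ (2 * k) :> R.
    have kV : 0 <= k%:R^-1 :> R by rewrite invr_ge0.
    apply: le_trans (bernoulli_expr _ kV); rewrite natrM mulfK ?gt_eqF//; lra.
  have -> : 1 + k%:R^-1 = ((1 + k%:R^-1) ^+ (2 * k)) `^ (2 * k%:R)^-1 :> R.
    by rewrite -powR_mulrn// -powRrM natrM divff ?powRr1// gt_eqF// mulr_gt0.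
  by apply: ge0_ler_powR; rewrite ?nnegrE ?invr_ge0 ?mulr_ge0 ?exprn_ge0.
have := BH_lp_succ k0 (powR_ge0 _ _) (@KS_ineq_le R k k0) (ltW kR) (IH k0).
move=> H n a; apply: (le_trans (H n a)); rewrite ler_wpM2r ?mult_sup_norm_ge0//.
by rewrite E ler_pM2r.
Qed.

Lemma leq_bin (m k : nat) : (0 < k < m)%N -> (m <= 'C(m, k))%N.
Proof.
move=> /andP[]; case: k => // k _; elim: m k => // m IH k; rewrite ltnS => km.
rewrite binS; case: (ltnP k.+1 m) => [km'|mk].
  rewrite -addn1 leq_add ?IH// bin_gt0; exact: ltnW.
have -> : m = k.+1 by apply/eqP; rewrite eqn_leq mk km.
by rewrite binn binSn.
Qed.

Lemma BH_ineq_weaken (p q : R) m (C C' : R) : C <= C' -> BH_ineq p q m C -> BH_ineq p q m C'.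
Proof.
by move=> CC BH n a; apply: (le_trans (BH n a)); rewrite ler_wpM2r ?mult_sup_norm_ge0.
Qed.

End Constants.

Unset Implicit Arguments.

Theorem theorem4p11 (R : realType) :
  (forall m k : nat, (1 <= k)%N -> (k <= m)%N ->
     (BHmult_lorentz (2 * m%:R / (m%:R + 1)) (2 * k%:R / (k%:R + 1)) m
      <= 2%:E * ('C(m, k)%:R `^ (3 / 2))%:E
           * (KS_const (2 * k%:R / (k%:R + 1) : R) ^+ (m - k))
           * BHmult_lp (2 * k%:R / (k%:R + 1) : R) k)%E) /\
  (forall k : nat, (1 <= k)%N ->
     exists delta : R, 0 < delta /\
       forall m : nat, (k < m)%N ->
         (BHmult_lorentz (2 * m%:R / (m%:R + 1))
            (2 * (m - k)%:R / ((m - k)%:R + 1)) m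
          <= (m%:R `^ delta)%:E)%E).
Proof.
have KS1 j : (0 < j)%N -> 1 <= 2 `^ (2 * j%:R)^-1 :> R.
  move=> j0; rewrite -[X in X <= _](powRr0 (2 : R)).
  by apply: ler_powR; rewrite ?ler1n// invr_ge0 mulr_ge0.
split=> [m k k0 km|k k0].
  (* The explicit constants show that both infima are finite and attained, so the right side is a
     product of reals. *)
  have [A [-> A1 KS]] := KS_const_attained (KS1 _ k0) (@KS_ineq_le R k k0).
  have k1 : 1 <= k%:R :> R by rewrite ler1n.
  have [B [EB B1 BH]] := BH_const_attained k1 (@BH_lp_poly R k k0).
  rewrite /BHmult_lp EB -EFin_expe -!EFinM.
  have A0 : 0 <= A := le_trans ler01 A1.
  have B0 : 0 <= B := le_trans ler01 B1.
  have An : 1 <= A ^+ (m - k) by exact: exprn_ege1.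
  have AB1 : 1 <= A ^+ (m - k) * B by rewrite mulr_ege1.
  have C1 : 1 <= 'C(m, k)%:R `^ (3 / 2) :> R.
    rewrite -[X in X <= _](powRr0 ('C(m, k)%:R : R)).
    by apply: ler_powR; rewrite ?ler1n ?bin_gt0.
  have C2 : 'C(m, k)%:R `^ (3 / 2) * (A ^+ (m - k) * B)
      <= 2 * 'C(m, k)%:R `^ (3 / 2) * A ^+ (m - k) * B.
    rewrite -!mulrA ler_peMl ?ler1n// !mulr_ge0 ?powR_ge0 ?exprn_ge0//.
  apply: BH_const_le; first by apply: le_trans C2; rewrite mulr_ege1.
  apply: BH_ineq_weaken C2 _.
  (* For k = m the two Lorentz norms coincide and the bound is the inequality for [B] itself; the
     windows serve k < m, where m is at most the binomial coefficient. *)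
  have [kE|] := ltnP k m; last first.
    move=> mk; have -> : m = k by apply/eqP; rewrite eqn_leq km mk.
    by rewrite binn powR1 subnn expr0 !mul1r.
  have kmm : (0 < k < m)%N by rewrite k0 kE.
  apply: BH_ineq_weaken (BH_lorentz_ineq kmm A0 KS B0 BH).
  rewrite ler_wpM2r ?(le_trans ler01)//.
  by apply: ge0_ler_powR; rewrite ?nnegrE// ler_nat leq_bin.
(* For j = m - k, only [k] coordinates are eliminated. The Khinchine constant is at most 2 <= m and
   the Bohnenblust--Hille constant at most j <= m, so the bound is m^(3/2) m^k m. *)
exists (3 / 2 + (k.+1)%:R); split; first by rewrite addr_gt0// divr_gt0.
move=> m km.
have j0 : (0 < m - k)%N by rewrite subn_gt0.
have jm : (0 < m - k < m)%N by rewrite j0 ltn_subrL k0 (leq_ltn_trans _ km).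
have m1 : 1 <= m%:R :> R by rewrite ler1n (leq_ltn_trans _ km).
have m2 : 2 <= m%:R :> R by rewrite ler_nat (leq_ltn_trans k0 km).
have KS := @KS_ineq_le R _ j0.
have BH := BH_lorentz_ineq jm (powR_ge0 _ _) KS (ler0n R _) (@BH_lp_poly R _ j0).
apply: BH_const_le.
  rewrite -[X in X <= _](powRr0 (m%:R : R)).
  by apply: ler_powR => //; rewrite addr_ge0.
apply: BH_ineq_weaken BH.
rewrite subKn ?(ltnW km)// powRD; last by rewrite (gt_eqF (lt_le_trans ltr01 m1)) implybT.
rewrite ler_wpM2l ?powR_ge0// powR_mulrn// exprSr.
apply: ler_pM; rewrite ?exprn_ge0 ?powR_ge0 ?ler_nat ?leq_subr//.
apply: lerXn2r; rewrite ?nnegrE ?powR_ge0//; apply: le_trans m2.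
rewrite -[leRHS](powRr1 (ler0n R 2)); apply: ler_powR; first by rewrite ler1n.
by rewrite invf_le1 ?mulr_gt0 ?ltr0n// -natrM ler1n muln_gt0.
Qed.
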